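(* Let $K$ be a field of characteristic zero. For $n\ge 1$ let $F_n$ be the rational self-map of the affine space of quadruples of $n\times n$ matrices over $K$ given by \[ F_n(a,b,c,d)=\bigl(C(b,a),\ C(C(a,c),C(a,b)),\ C(C(b,d),C(b,c)),\ C(c,d)\bigr), \] where $C(y,x)=(y-x)x(y-x)^{-1}$. Then for every $n\ge 2$, \[ \deg(F_n)\ge 3 . \]
   Context: The map $F_n$ is dominant and generically finite as a rational map of affine space of dimension $4n^2$. $\deg$ is the generic geometric degree of a dominant generically finite rational map, computed after extension to an algebraic closure. *)

(* Defs.v *)
From mathcomp Require Import all_boot all_order all_algebra.
From mathcomp.multinomials Require Import mpoly.

Set Implicit Arguments.
Unset Strict Implicit.
Unset Printing Implicit Defensive.

Import GRing.Theory.
Local Open Scope ring_scope.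

Definition quad (R : Type) (n : nat) : Type :=
  ('M[R]_n * 'M[R]_n * 'M[R]_n * 'M[R]_n)%type.

Definition qdim (n : nat) : nat := (n * n + n * n + n * n + n * n)%N.

Definition qcoord (R : Type) (n : nat) (q : quad R n) : 'I_(qdim n) -> R :=
  let: (a, b, c, d) := q in
  row_mx (row_mx (row_mx (mxvec a) (mxvec b)) (mxvec c)) (mxvec d) ord0.

(* A rational self-map of the affine space of quadruples over an algebraically
   closed field L is given by its values f on a domain dom.  Its generic
   geometric degree is d when, for all y outside some proper hypersurface
   P = 0 (equivalently, for all y in some nonempty Zariski open set), the
   fibre over y consists of exactly d points.  Having degree d > 0 thus
   includes being dominant and generically finite. *)
Definition has_geometric_degree (L : closedFieldType) (n : nat)
    (dom : pred (quad L n)) (f : quad L n -> quad L n) (d : nat) : Prop :=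
  exists2 P : {mpoly L[qdim n]}, P != 0 &
    forall y : quad L n, P.@[qcoord y] != 0 ->
      exists s : seq (quad L n),
        [/\ uniq s, size s = d
          & forall x, (x \in s) = dom x && (f x == y)].

(* Meaningful only when y - x is invertible: invmx is the identity on
   singular matrices. *)
Definition C (R : comUnitRingType) (n : nat) (y x : 'M[R]_n) : 'M[R]_n :=
  (y - x) *m x *m invmx (y - x).

Definition C_dom (R : comUnitRingType) (n : nat) (y x : 'M[R]_n) : bool :=
  y - x \in unitmx.

Definition F (R : comUnitRingType) (n : nat) (q : quad R n) : quad R n :=
  let: (a, b, c, d) := q in
  (C b a, C (C a c) (C a b), C (C b d) (C b c), C c d).

Definition F_dom (R : comUnitRingType) (n : nat) (q : quad R n) : bool :=
  let: (a, b, c, d) := q in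
  [&& C_dom b a,
      C_dom a c, C_dom a b, C_dom (C a c) (C a b),
      C_dom b d, C_dom b c, C_dom (C b d) (C b c)
    & C_dom c d].

(* Main.v *)
Require Import Defs.
From HB Require Import structures.
From Stdlib Require Import Classical_Prop.
From mathcomp Require Import all_boot all_order all_algebra.
From mathcomp.multinomials Require Import mpoly.
From mathcomp Require Import ring zify separable.

(** Let [L] be algebraically closed of characteristic zero, [E] the field of
    rational functions in the [N] coordinates of the source, and let
    [f_1, ..., f_N] in [E] be the coordinates of a rational self-map of affine
    [N]-space.  If the [f_i] are algebraically independent, then [E] is a finite
    extension of [L(f)], and the degree of the map is [[E : L(f)]].  Indeed, take
    a primitive element [u], a polynomial in the coordinates, with minimal
    polynomial [M]; each coordinate of the source is a polynomial [r_i] in [u]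
    over [L(f)].  For generic [y] the coefficients of [M] and of the [r_i] can be
    specialised at [y], and [u] and [r] become inverse bijections between the
    fibre over [y] and the roots of [M_y], which are simple because the
    characteristic is zero.  This is [generic_fibre_count].

    The degree is at least [e] as soon as one fibre contains [e] points at which
    the derivative is invertible.  Let [w] be a polynomial with distinct values
    at these points and suppose that [a_0(f) + ... + a_(e-1)(f) w^(e-1) = 0] with
    [a_i] not all zero.  Let [m] be the smallest order of vanishing of the [a_i]
    at the common image [y_0].  Through each of the [e] points there is an arc
    whose image leaves [y_0] in a prescribed direction [v]; along it, the terms
    of order [m] say that the value of [w] at the point is a root of the
    polynomial whose coefficients are the values at [v] of the order [m] parts of
    the [a_i].  That polynomial has degree less than [e] and [e] roots, so it
    vanishes, for every [v]: a contradiction.  This is [etale_independence]; with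
    [e = 1] it also gives the algebraic independence of the [f_i].

    It remains to find three such points for [F] over one value.  They are taken
    with [a^2 = 0] and [b^2 = d^2 = 1].  Then [C b d = - b], and the third
    component of [F] is [c] itself.  Since a conjugate of a square root of a
    scalar is again one, a tangent vector [(a_1, b_1, c_1, d_1)] killed by the
    derivative satisfies [b b_1 + b_1 b = 0] and [d d_1 + d_1 d = 0], which forces
    [c_1 = d_1 = 0]; what is left is a linear condition on [b_1], called [rigid]
    below.  Fixing [c], [C b a] and the second component still leaves several
    pairs [(a, b)]: three of them are given explicitly for 2 by 2 matrices, and
    adding the scalars [0, 1, -2, -1] as a diagonal block to [a, b, c, d] produces
    points for every [n >= 2]. *)

Set Implicit Arguments.
Unset Strict Implicit.
Unset Printing Implicit Defensive.

Import GRing.Theory.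
Local Open Scope ring_scope.
Local Notation "x %:F" := (@FracField.tofrac _ x).

(** * Partial evaluation of fractions *)

Section FractionValue.

Variables (R : idomainType) (M : fieldType) (phi : {rmorphism R -> M}).

(** A relation, since a fraction has a value only when some denominator of it is
    not killed by [phi]. *)
Definition fracval (z : {fraction R}) (v : M) : Prop :=
  exists n d, [/\ phi d != 0, z = n%:F / d%:F & v = phi n / phi d].

Let nz_den d : phi d != 0 -> d%:F != 0.
Proof. by apply: contraNneq => /eqP; rewrite tofrac_eq0 => /eqP->; rewrite rmorph0. Qed.

Lemma fracval_tofrac n : fracval n%:F (phi n).
Proof.
by exists n, 1; rewrite rmorph1 oner_neq0 tofrac1 !divr1.
Qed.

Lemma fracval_uniq z v w : fracval z v -> fracval z w -> v = w.
Proof.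
move=> [n [d [d0 -> ->]]] [n' [d' [d'0 eqz ->]]].
apply/eqP; rewrite eqr_div // -!rmorphM; apply/eqP; congr (phi _).
apply/eqP; rewrite -tofrac_eq !tofracM -eqr_div ?nz_den //.
exact/eqP.
Qed.

Lemma fracvalD z w v v' :
  fracval z v -> fracval w v' -> fracval (z + w) (v + v').
Proof.
move=> [n [d [d0 -> ->]]] [n' [d' [d'0 -> ->]]].
exists (n * d' + n' * d), (d * d'); split.
- by rewrite rmorphM mulf_neq0.
- by rewrite tofracD !tofracM addf_div ?nz_den.
- by rewrite rmorphD !rmorphM addf_div.
Qed.

Lemma fracvalM z w v v' :
  fracval z v -> fracval w v' -> fracval (z * w) (v * v').
Proof.
move=> [n [d [d0 -> ->]]] [n' [d' [d'0 -> ->]]].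
exists (n * n'), (d * d'); split.
- by rewrite rmorphM mulf_neq0.
- by rewrite !tofracM mulf_div.
- by rewrite !rmorphM mulf_div.
Qed.

Lemma fracval0 : fracval 0 0.
Proof. by rewrite -(rmorph0 phi) -tofrac0; apply: fracval_tofrac. Qed.

Lemma fracval1 : fracval 1 1.
Proof. by rewrite -(rmorph1 phi) -tofrac1; apply: fracval_tofrac. Qed.

Lemma fracvalN z v : fracval z v -> fracval (- z) (- v).
Proof.
rewrite -mulN1r -[- v]mulN1r; apply: fracvalM.
by rewrite -(rmorphN1 phi) -tofrac1 -tofracN; apply: fracval_tofrac.
Qed.

Lemma fracvalB z w v v' :
  fracval z v -> fracval w v' -> fracval (z - w) (v - v').
Proof. by move=> zv /fracvalN; apply: fracvalD. Qed.

Lemma fracval_neq0 z v : fracval z v -> v != 0 -> z != 0.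
Proof.
move=> zv; apply: contraNneq => z0; rewrite z0 in zv.
by rewrite (fracval_uniq zv fracval0).
Qed.

Lemma fracvalV z v : fracval z v -> v != 0 -> fracval z^-1 v^-1.
Proof.
move=> [n [d [d0 -> ->]]]; rewrite mulf_eq0 invr_eq0 negb_or => /andP[n0 _].
by exists d, n; rewrite n0 !invf_div.
Qed.

Lemma fracval_sum (I : Type) (r : seq I) (P : pred I) z v :
  (forall i, P i -> fracval (z i) (v i)) ->
  fracval (\sum_(i <- r | P i) z i) (\sum_(i <- r | P i) v i).
Proof.
move=> zv; elim/big_ind2: _ => // [|z1 v1 z2 v2]; first exact: fracval0.
exact: fracvalD.
Qed.

Lemma fracval_prod (I : Type) (r : seq I) (P : pred I) z v :
  (forall i, P i -> fracval (z i) (v i)) ->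
  fracval (\prod_(i <- r | P i) z i) (\prod_(i <- r | P i) v i).
Proof.
move=> zv; elim/big_ind2: _ => // [|z1 v1 z2 v2]; first exact: fracval1.
exact: fracvalM.
Qed.

Lemma fracvalX z v k : fracval z v -> fracval (z ^+ k) (v ^+ k).
Proof.
by move=> zv; elim: k => [|k IH]; [apply: fracval1 | rewrite !exprS; apply: fracvalM].
Qed.

Lemma fracval_mmap (L : nzRingType) (N : nat) (kE : L -> {fraction R})
    (kM : L -> M) z v (p : {mpoly L[N]}) :
  (forall c, fracval (kE c) (kM c)) -> (forall i, fracval (z i) (v i)) ->
  fracval (mmap kE z p) (mmap kM v p).
Proof.
move=> kv zv; apply: fracval_sum => m _; apply: fracvalM => //.
by apply: fracval_prod => i _; apply: fracvalX.
Qed.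

Definition fracval_poly (p : {poly {fraction R}}) (q : {poly M}) : Prop :=
  forall i, fracval p`_i q`_i.

Lemma fracval_poly_uniq p q q' :
  fracval_poly p q -> fracval_poly p q' -> q = q'.
Proof. by move=> pq pq'; apply/polyP => i; apply: fracval_uniq (pq i) (pq' i). Qed.

Lemma fracval_polyD p q p' q' :
  fracval_poly p q -> fracval_poly p' q' -> fracval_poly (p + p') (q + q').
Proof. by move=> pq pq' i; rewrite !coefD; apply: fracvalD. Qed.

Lemma fracval_polyB p q p' q' :
  fracval_poly p q -> fracval_poly p' q' -> fracval_poly (p - p') (q - q').
Proof. by move=> pq pq' i; rewrite !coefB; apply: fracvalB. Qed.

Lemma fracval_polyM p q p' q' :
  fracval_poly p q -> fracval_poly p' q' -> fracval_poly (p * p') (q * q').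
Proof.
by move=> pq pq' i; rewrite !coefM; apply: fracval_sum => j _; apply: fracvalM.
Qed.

Lemma fracval_polyC z v : fracval z v -> fracval_poly z%:P v%:P.
Proof. by move=> zv i; rewrite !coefC; case: eqP => // _; apply: fracval0. Qed.

Lemma fracval_polyX : fracval_poly 'X 'X.
Proof.
by move=> i; rewrite !coefX; case: eqP => _; [apply: fracval1 | apply: fracval0].
Qed.

Lemma fracval_poly_deriv p q :
  fracval_poly p q -> fracval_poly p^`() q^`().
Proof.
move=> pq i; rewrite !coef_deriv -mulr_natr -[q`_i.+1 *+ _]mulr_natr.
apply: fracvalM => //; rewrite -(rmorph_nat phi) -(rmorph_nat (@FracField.tofrac R)).
exact: fracval_tofrac.
Qed.

Lemma fracval_poly_sum (I : Type) (r : seq I) (P : pred I) p q :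
  (forall i, P i -> fracval_poly (p i) (q i)) ->
  fracval_poly (\sum_(i <- r | P i) p i) (\sum_(i <- r | P i) q i).
Proof. by move=> pq j; rewrite !coef_sum; apply: fracval_sum => i Pi; apply: pq. Qed.

Lemma fracval_poly_prod (I : Type) (r : seq I) (P : pred I) p q :
  (forall i, P i -> fracval_poly (p i) (q i)) ->
  fracval_poly (\prod_(i <- r | P i) p i) (\prod_(i <- r | P i) q i).
Proof.
move=> pq; elim/big_ind2: _ => // [|? ? ? ?].
  by rewrite -!polyC1; apply/fracval_polyC/fracval1.
exact: fracval_polyM.
Qed.

Lemma fracval_poly_exp p q k :
  fracval_poly p q -> fracval_poly (p ^+ k) (q ^+ k).
Proof.
move=> pq; elim: k => [|k IH]; last by rewrite !exprS; apply: fracval_polyM.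
by rewrite !expr0 -!polyC1; apply/fracval_polyC/fracval1.
Qed.

Lemma fracval_poly_mmap (L : nzRingType) (N : nat) (kE : L -> {poly {fraction R}})
    (kM : L -> {poly M}) z v (p : {mpoly L[N]}) :
  (forall c, fracval_poly (kE c) (kM c)) -> (forall i, fracval_poly (z i) (v i)) ->
  fracval_poly (mmap kE z p) (mmap kM v p).
Proof.
move=> kv zv; apply: fracval_poly_sum => m _; apply: fracval_polyM => //.
by apply: fracval_poly_prod => i _; apply: fracval_poly_exp.
Qed.

Lemma fracval_horner p q z v :
  fracval_poly p q -> fracval z v -> fracval p.[z] q.[v].
Proof.
move=> pq zv; pose k := maxn (size p) (size q).
rewrite (horner_coef_wide _ (leq_maxl (size p) (size q))).
rewrite (horner_coef_wide _ (leq_maxr (size p) (size q))).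
by apply: fracval_sum => i _; apply: fracvalM => //; apply: fracvalX.
Qed.

End FractionValue.

Lemma fraction_repr (R : idomainType) (z : {fraction R}) :
  z = (\n_(repr z))%:F / (\d_(repr z))%:F.
Proof.
apply: (canRL (mulfK _)); first by rewrite tofrac_eq0 denom_ratioP.
rewrite -[X in X * _ = _]reprK; move: (repr z) => x.
unlock FracField.tofrac; rewrite -[LHS]FracField.pi_mul; apply/eqmodP => /=.
rewrite FracField.equivfE /FracField.mulf !numden_Ratio ?oner_eq0 ?mulf_neq0
  ?denom_ratioP //.
  by rewrite !mulr1 mulrC.
all: exact: oner_neq0.
Qed.

Lemma fraction_numden (R : idomainType) (z : {fraction R}) :
  exists n d : R, d != 0 /\ z = n%:F / d%:F.
Proof.
exists (\n_(repr z)), (\d_(repr z)); split; first exact: denom_ratioP.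
exact: fraction_repr.
Qed.

Section FractionLift.

Variables (R : idomainType) (M : fieldType) (phi : {rmorphism R -> M}).

(** When [phi] is injective every fraction has a value, and evaluation becomes a
    field morphism. *)
Definition fraclift (phi_inj : injective phi) (z : {fraction R}) : M :=
  phi (\n_(repr z)) / phi (\d_(repr z)).

Hypothesis phi_inj : injective phi.

Lemma fracliftP z : fracval phi z (fraclift phi_inj z).
Proof.
exists (\n_(repr z)), (\d_(repr z)); split=> //; last exact: fraction_repr.
by rewrite -(rmorph0 phi) (inj_eq phi_inj) denom_ratioP.
Qed.

Lemma fraclift_is_zmod_morphism : zmod_morphism (fraclift phi_inj).
Proof.
move=> z w; apply: fracval_uniq (fracliftP _) _.
by apply: fracvalB; apply: fracliftP.
Qed.

HB.instance Definition _ := GRing.isZmodMorphism.Build _ _ (fraclift phi_inj)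
  fraclift_is_zmod_morphism.

Lemma fraclift_is_monoid_morphism : monoid_morphism (fraclift phi_inj).
Proof.
split=> [|z w]; first exact: fracval_uniq (fracliftP _) (fracval1 phi).
by apply: fracval_uniq (fracliftP _) _; apply: fracvalM; apply: fracliftP.
Qed.

HB.instance Definition _ := GRing.isMonoidMorphism.Build _ _ (fraclift phi_inj)
  fraclift_is_monoid_morphism.

Lemma fraclift_tofrac a : fraclift phi_inj a%:F = phi a.
Proof. exact: fracval_uniq (fracliftP _) (fracval_tofrac _ _). Qed.

End FractionLift.

(** * Algebraic dependence of more than N fractions in N variables *)

Lemma linear_dependence (L : fieldType) (I K : finType) (A : I -> K -> L) :
  (#|K| < #|I|)%N ->
  exists lam : I -> L, (exists i, lam i != 0) /\
    forall k, \sum_i lam i * A i k = 0.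
Proof.
move=> ltKI; pose M := \matrix_(i < #|I|, k < #|K|) A (enum_val i) (enum_val k).
have /rowV0Pn[v /sub_kermxP vM v0] : kermx M != 0.
  rewrite kermx_eq0; apply: contraL ltKI => /eqP rM.
  by rewrite -leqNgt -rM rank_leq_col.
have /rV0Pn[i vi0] := v0.
exists (fun i => v 0 (enum_rank i)); split.
  by exists (enum_val i); rewrite enum_valK.
move=> k; have /matrixP/(_ 0 (enum_rank k)) := vM; rewrite !mxE => vMk.
rewrite -[RHS]vMk.
rewrite [RHS](reindex (@enum_rank I)) /=; last exact/onW_bij/enum_rank_bij.
by apply: eq_bigr => j _; rewrite mxE !enum_rankK.
Qed.

Section AlgebraicDependence.

Variables (L : fieldType) (N : nat).
Local Notation E := {fraction {mpoly L[N]}}.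

Definition constF (c : L) : E := (c%:MP)%:F.

Let msize_mul_le k l (p q : {mpoly L[N]}) :
  (msize p <= k.+1)%N -> (msize q <= l.+1)%N -> (msize (p * q) <= (k + l).+1)%N.
Proof.
move=> pk ql; have [->|p0] := eqVneq p 0; first by rewrite mul0r msize0.
have [->|q0] := eqVneq q 0; first by rewrite mulr0 msize0.
rewrite msizeM // -subn1 leq_subLR add1n.
by apply: leq_trans (leq_add pk ql) _; rewrite addSn addnS.
Qed.

Let msize_prod_le (I : finType) k (p : I -> {mpoly L[N]}) :
  (forall i, (msize (p i) <= k.+1)%N) -> (msize (\prod_i p i) <= (#|I| * k).+1)%N.
Proof.
move=> pk; rewrite -sum_nat_const.
elim/big_ind2: _ => // [|l q l' q']; first by rewrite msize1.
exact: msize_mul_le.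
Qed.

Let msize_exp_le k l (p : {mpoly L[N]}) :
  (msize p <= k.+1)%N -> (msize (p ^+ l) <= (l * k).+1)%N.
Proof.
move=> pk; elim: l => [|l IH]; first by rewrite expr0 msize1.
by rewrite exprS mulSn; apply: msize_mul_le.
Qed.

(** Write the fractions over a common denominator [q].  The products of their
    powers with exponents below [D], multiplied by one large power of [q], are
    polynomials in [N] variables of degree [O(D)], hence lie in a space of
    dimension [O(D ^ N)], whereas there are at least [D ^ N.+1] of them. *)
Lemma algebraic_dependence (J : finType) (z : J -> E) :
  (N < #|J|)%N ->
  exists (D : nat) (lam : {ffun J -> 'I_D} -> L), (exists m, lam m != 0) /\
    \sum_m constF (lam m) * \prod_j z j ^+ m j = 0.
Proof.
move=> ltNJ.
have /fin_all_exists[n /fin_all_exists[d nd]] := fun j => fraction_numden (z j).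
pose q := \prod_j d j.
have q0 : q != 0 by apply/prodf_neq0 => j _; have [] := nd j.
pose p j := n j * \prod_(i | i != j) d i.
have zE j : z j = (p j)%:F / q%:F.
  have [_ ->] := nd j; have -> : q = d j * \prod_(i | i != j) d i.
    by rewrite /q (bigD1 j).
  rewrite /p !tofracM -mulf_div divff ?mulr1 // tofrac_eq0.
  by apply/prodf_neq0 => i _; have [] := nd i.
pose k := maxn (msize q) (\max_j msize (p j)).
pose D := ((#|J| * k).+1 ^ N).+1.
pose K := (#|J| * (D * k)).+1.
pose W (m : {ffun J -> 'I_D}) := \prod_j (p j ^+ m j * q ^+ (D - m j)).
have Wsize m : (msize (W m) <= K)%N.
  apply: msize_prod_le => j.
  rewrite -[X in (X * k)%N](subnKC (ltnW (ltn_ord (m j)))) mulnDl.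
  apply: msize_mul_le; apply: msize_exp_le; rewrite ltnW // ltnS /k.
    by rewrite leq_max (leq_bigmax (F := fun j => msize (p j))) orbT.
  by rewrite leq_maxl.
(* The products W m have degree less than K, so each of their monomials has all
   its exponents below K. *)
pose mon (e : {ffun 'I_N -> 'I_K}) := [multinom (e i : nat) | i < N].
have cardKI : (#|{: {ffun 'I_N -> 'I_K}}| < #|{: {ffun J -> 'I_D}}|)%N.
  rewrite !card_ffun !card_ord.
  apply: (@leq_trans (D ^ N.+1)); last by rewrite leq_pexp2l.
  rewrite expnS; apply: (@leq_ltn_trans ((#|J| * k).+1 ^ N * D ^ N)).
    have [->|N0] := posnP N; first by rewrite !expn0.
    rewrite -expnMn leq_exp2r // /K mulSn mulnCA addnC mulnC.
    by rewrite -addn1 leq_add // mulnC leq_mul.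
  by rewrite ltn_mul2r expn_gt0 /=.
have [lam [lam0 lamW]] := linear_dependence (fun m e => (W m)@_(mon e)) cardKI.
exists D, lam; split=> //.
have sumW : \sum_m lam m *: W m = 0.
  apply/mpolyP => e; rewrite mcoeff0 raddf_sum /=.
  under eq_bigr => m _ do rewrite mcoeffZ.
  have [le|ge] := ltnP (mdeg e) K.
    have eK i : (e i < K)%N.
      by apply: leq_ltn_trans le; rewrite mdegE (bigD1 i) //= leq_addr.
    rewrite -[RHS](lamW [ffun i => Ordinal (eK i)]).
    apply: eq_bigr => m _; congr (_ * (W m)@__).
    by apply/mnmP => i; rewrite mnmE ffunE.
  rewrite big1 // => m _; rewrite memN_msupp_eq0 ?mulr0 //.
  by apply: msize_mdeg_ge; apply: leq_trans (Wsize m) ge.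
have q0F : q%:F != 0 by rewrite tofrac_eq0.
have qX0 : (q%:F) ^+ (#|J| * D) != 0 by rewrite expf_neq0.
apply: (mulfI qX0); rewrite mulr0 -[RHS](tofrac0 {mpoly L[N]}) -sumW.
rewrite raddf_sum mulr_sumr; apply: eq_bigr => m _ /=.
rewrite -mul_mpolyC tofracM mulrCA; congr (_ * _).
have -> : (q%:F) ^+ (#|J| * D) = \prod_(j : J) (q%:F) ^+ D.
  by rewrite prodr_const mulnC exprM.
rewrite /W -big_split [RHS]rmorph_prod.
apply: eq_bigr => j _; rewrite /= tofracM !tofracXn zE.
rewrite -[X in q%:F ^+ X](subnKC (ltnW (ltn_ord (m j)))) exprD exprMn exprVn.
by rewrite mulrC -mulrA (mulKf (expf_neq0 _ q0F)).
Qed.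

End AlgebraicDependence.

(** * Points where a polynomial does not vanish *)

Lemma rmorph_mmap (L : nzRingType) (S U : comNzRingType) (g : {rmorphism S -> U})
    (k : L -> S) N (h : 'I_N -> S) (p : {mpoly L[N]}) :
  g (mmap k h p) = mmap (g \o k) (g \o h) p.
Proof.
rewrite /mmap rmorph_sum; apply: eq_bigr => m _; rewrite rmorphM; congr (_ * _).
by rewrite /mmap1 rmorph_prod; apply: eq_bigr => i _; rewrite rmorphXn.
Qed.

Lemma eq_mmap (L S : nzRingType) N (k k' : L -> S) (h h' : 'I_N -> S)
  (p : {mpoly L[N]}) : k =1 k' -> h =1 h' -> mmap k h p = mmap k' h' p.
Proof.
move=> kk' hh'; apply: eq_bigr => m _; rewrite kk'; congr (_ * _).
exact: mmap1_eq.
Qed.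

Lemma mmap_mpolyC (L : comNzRingType) N (p : {mpoly L[N]}) :
  mmap (@mpolyC N L) (fun i => 'X_i) p = p.
Proof.
rewrite {2}[p]mpolyE; apply: eq_bigr => m _.
by rewrite mmap1_id mul_mpolyC.
Qed.

Section NonVanishing.

Variables (L : idomainType) (L0 : [pchar L] =i pred0).

Lemma poly_nonroot_nat (R : idomainType) (R0 : [pchar R] =i pred0) (p : {poly R}) :
  p != 0 -> exists n : nat, ~~ root p n%:R.
Proof.
move=> p0; have /pcharf0P R0P := R0.
pose s := mkseq (fun n => n%:R : R) (size p).
have us : uniq s.
  apply/mkseq_uniqP => i j _ _ /eqP.
  wlog lij : i j / (i <= j)%N => [W|].
    by case: (leqP i j) => [/W //|/ltnW /W W' /eqP/esym/eqP/W'].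
  rewrite eq_sym -subr_eq0 -natrB // R0P subn_eq0 => lji.
  by apply/eqP; rewrite eqn_leq lij.
have /allPn[_ /mapP[n _ ->]] : ~~ all (root p) s; last by exists n.
by apply/negP => /(max_poly_roots p0)/(_ us); rewrite size_mkseq ltnn.
Qed.

(** The variables are replaced by constants one at a time: at each step the
    polynomial is a nonzero univariate polynomial in the next variable, with
    coefficients in an integral domain of characteristic zero, so that some
    natural number is not a root. *)
Lemma mpoly_nonvanishing N (p : {mpoly L[N]}) :
  p != 0 -> exists v : 'I_N -> L, p.@[v] != 0.
Proof.
move=> p0.
have part k : exists v : 'I_N -> L, mmap (@mpolyC N L)
    (fun i => if (i < k)%N then (v i)%:MP else 'X_i) p != 0.
  elim: k => [|k [v q0]]; first by exists (fun=> 0); rewrite mmap_mpolyC.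
  case: (ltnP k N) => [kN|Nk]; last first.
    exists v; congr (_ != 0): q0; apply: eq_mmap => // i.
    by rewrite (leq_trans (ltn_ord i) Nk) (leq_trans (ltn_ord i)) // leqW.
  move: q0; set q := mmap _ _ _ => q0; pose k0 := Ordinal kN.
  (* tau reads a polynomial as a polynomial in the variable k alone. *)
  pose tau := mmap (polyC \o @mpolyC N L)
    (fun i : 'I_N => if i == k0 then 'X else ('X_i)%:P) : _ -> {poly {mpoly L[N]}}.
  have tau0 : tau q != 0.
    apply: contraNneq q0 => tq0.
    have := rmorph0 (horner_eval ('X_k0 : {mpoly L[N]})).
    rewrite -tq0 rmorph_mmap => <-; rewrite -[X in X == _]mmap_mpolyC.
    apply/eqP/eq_mmap => i /=; first by rewrite horner_evalE hornerC.
    by case: eqP => [->|_]; rewrite horner_evalE ?hornerX ?hornerC.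
  have R0 : [pchar {mpoly L[N]}] =i pred0.
    move=> c; rewrite -(L0 c) !inE -(rmorph_nat (@mpolyC N L)).
    by rewrite mpolyC_eq0.
  have [n] := poly_nonroot_nat R0 tau0; rewrite /root -horner_evalE rmorph_mmap => tn0.
  exists (fun i => if i == k0 then n%:R else v i); move: tn0.
  rewrite /q rmorph_mmap; congr (_ != 0).
  apply: eq_mmap => i /=.
    by rewrite mmapC /= horner_evalE hornerC.
  have [->|nik] := eqVneq i k0.
    by rewrite ltnn ltnS leqnn mmapX mmap1U /= eqxx horner_evalE hornerX rmorph_nat.
  have -> : (i < k.+1)%N = (i < k)%N.
    by rewrite ltnS leq_eqVlt -[_ == _ :> nat]/(i == k0) (negbTE nik).
  case: ifP => _; rewrite ?mmapC ?mmapX ?mmap1U /= ?(negbTE nik);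
    by rewrite horner_evalE hornerC.
have [v] := part N.
rewrite (@eq_mmap _ _ _ _ (@mpolyC N L \o idfun) _ (@mpolyC N L \o v)) //.
  by rewrite -rmorph_mmap mpolyC_eq0; exists v.
by move=> i /=; rewrite ltn_ord.
Qed.

End NonVanishing.

(** The smallest order of vanishing at 0 in the family is factored out, which
    leaves a family that does not vanish entirely at 0. *)
Lemma poly_family_valuation (R : idomainType) e (A : 'I_e -> {poly R}) :
  (exists i, A i != 0) ->
  exists m (B : 'I_e -> {poly R}),
    (forall i, A i = 'X ^+ m * B i) /\ exists i, (B i).[0] != 0.
Proof.
move=> [i0 Ai0]; have [k] := ubnP (size (A i0)); elim: k A Ai0 => // k IH A Ai0 sA.
have [/existsP[i ni]|/existsPn al] := boolP [exists i, (A i).[0] != 0].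
  by exists 0%N, A; split; [move=> j; rewrite mul1r | exists i].
have /fin_all_exists[A' AE] : forall i, exists q, A i = 'X * q.
  move=> i; have /negPn/factor_theorem[q ->] := al i.
  by exists q; rewrite subr0 mulrC.
have A'i0 : A' i0 != 0 by apply: contraNneq Ai0 => q0; rewrite AE q0 mulr0.
have /IH : A' i0 != 0 by [].
case; first by move: sA; rewrite AE mulrC size_mulX // ltnS.
move=> m [B [A'E Bi]]; exists m.+1, B; split=> // i.
by rewrite AE A'E exprS mulrA.
Qed.

(** * Independence from points with invertible derivative *)

HB.instance Definition _ (L : fieldType) N :=
  GRing.RMorphism.copy (@constF L N) (@FracField.tofrac _ \o @mpolyC N L).

Definition constT (L : fieldType) (c : L) : {fraction {poly L}} := (c%:P)%:F.
HB.instance Definition _ (L : fieldType) :=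
  GRing.RMorphism.copy (@constT L) (@FracField.tofrac _ \o @polyC L).

Lemma constT_val (L : fieldType) (c : L) :
  fracval (horner_eval (0 : L)) (constT c) c.
Proof.
by have := fracval_tofrac (horner_eval (0 : L)) c%:P; rewrite /= horner_evalE hornerC.
Qed.

Lemma tT_val (L : fieldType) : fracval (horner_eval (0 : L)) ('X : {poly L})%:F 0.
Proof.
by have := fracval_tofrac (horner_eval (0 : L)) 'X; rewrite /= horner_evalE hornerX.
Qed.

Section Etale.

Variables (L : fieldType) (L0 : [pchar L] =i pred0) (N : nat).
Local Notation E := {fraction {mpoly L[N]}}.
Local Notation T := {fraction {poly L}}.
Local Notation tT := ('X : {poly L})%:F.

(** Every direction [v] at [y] is the velocity of the image under [f] of an arc
    through [x].  Arcs have coordinates in [L(t)] that are defined at [t = 0], and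
    [h] is the image of the arc [X].  For a map that is regular at [x] this says
    that the derivative at [x] is surjective; arcs make it usable for fractions
    without a calculus of partial derivatives. *)
Definition etale (f : 'I_N -> E) (x y : 'I_N -> L) : Prop :=
  forall v : 'I_N -> L, exists (X h g : 'I_N -> T), forall k,
    [/\ fracval (horner_eval 0) (X k) (x k),
        fracval (mmap (@constT L) X) (f k) (h k),
        h k = constT (y k) + tT * g k
      & fracval (horner_eval 0) (g k) (v k)].

(** Expand [a_i(y + t Y) = t ^ m * B_i(t, Y)] with [m] the smallest order in the
    family, so that some [B_i(0, Y)] is nonzero and does not vanish at some [v].
    Along the arc through [x_j] with velocity [v], the relation divided by [t ^ m]
    becomes at [t = 0] the equation [sum_i B_i(0, v) w(x_j) ^ i = 0].  This
    polynomial of degree less than [e] has the [e] distinct roots [w(x_j)]. *)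
Lemma etale_independence (f : 'I_N -> E) (y : 'I_N -> L) e
    (x : 'I_e -> 'I_N -> L) (w : {mpoly L[N]}) :
  (forall j, etale f (x j) y) -> injective (fun j => w.@[x j]) ->
  forall a : 'I_e -> {mpoly L[N]},
    \sum_i mmap (@constF L N) f (a i) * w%:F ^+ i = 0 -> forall i, a i = 0.
Proof.
move=> et winj a rel i0; apply/eqP/negPn/negP => ai0.
(* A i is a_i(y + t Y), as a polynomial in t over the polynomials in Y. *)
pose A i : {poly {mpoly L[N]}} := mmap (polyC \o @mpolyC N L)
  (fun k => (y k)%:MP%:P + 'X * ('X_k)%:P) (a i).
have Ai0 : A i0 != 0.
  apply: contraNneq ai0 => A0.
  (* Setting t = 1 and Y = X - y recovers a_i. *)
  pose g := mmap (@mpolyC N L) (fun k : 'I_N => 'X_k - (y k)%:MP).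
  have : g (A i0).[1] = 0 by rewrite A0 horner0 /g raddf0.
  rewrite -horner_evalE /g !rmorph_mmap -/g => aE; apply/eqP.
  rewrite -[RHS]aE -[LHS]mmap_mpolyC.
  apply/eq_mmap => k /=; first by rewrite horner_evalE hornerC mmapC.
  rewrite horner_evalE !hornerE rmorphD /= mmapC mmapX mmap1U.
  by rewrite addrC subrK.
have [m [B [AB [i1 Bi1]]]] := poly_family_valuation (ex_intro _ i0 Ai0).
have [v Bv] := mpoly_nonvanishing L0 Bi1.
have const_res := @constT_val L; have t_res := @tT_val L.
have rootw j : \sum_(i < e) (B i).[0].@[v] * w.@[x j] ^+ i = 0.
  have [X [h [g /all_and4[Xx fh hg gv]]]] := et j v.
  (* Evaluation along the arc: t at itself and Y at g, the direction of the image. *)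
  pose psi (p : {poly {mpoly L[N]}}) : T := (map_poly (mmap (@constT L) g) p).[tT].
  pose W := mmap (@constT L) X w.
  have psiA i : psi (A i) = mmap (@constT L) h (a i).
    rewrite /psi -horner_evalE /A !rmorph_mmap; apply: eq_mmap => k /=.
      by rewrite map_polyC horner_evalE hornerC /= mmapC.
    rewrite rmorphD rmorphM /= !map_polyC map_polyX horner_evalE !hornerE /=.
    by rewrite mmapC mmapX mmap1U hg.
  have arc : \sum_i psi (A i) * W ^+ i = 0.
    apply: (@fracval_uniq _ _ (mmap (@constT L) X) 0); last exact: fracval0.
    rewrite -rel; apply: fracval_sum => i _; apply: fracvalM.
      rewrite psiA; apply: fracval_mmap => // c.
      have := fracval_tofrac (mmap (@constT L) X) c%:MP; by rewrite /= mmapC.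
    apply: fracvalX; exact: (fracval_tofrac (mmap (@constT L) X)).
  have {}arc : \sum_i psi (B i) * W ^+ i = 0.
    have t0 : tT ^+ m != 0 by rewrite expf_neq0 // tofrac_eq0 polyX_eq0.
    apply: (mulfI t0); rewrite mulr0 -[RHS]arc mulr_sumr; apply: eq_bigr => i _.
    rewrite mulrA; congr (_ * _).
    by rewrite AB /psi rmorphM rmorphXn /= map_polyX hornerM hornerXn.
  apply: (@fracval_uniq _ _ (horner_eval 0) 0); last exact: fracval0.
  rewrite -arc; apply: fracval_sum => i _; apply: fracvalM.
    have -> : (B i).[0].@[v] = (map_poly (meval v) (B i)).[0].
      by rewrite -[X in _ = _.[X]](meval0 v) (horner_map (meval v)).
    apply: fracval_horner => // k.
    by rewrite !coef_map /=; apply: fracval_mmap.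
  apply: fracvalX; exact: fracval_mmap.
(* insubd i0 is the identity on the indices i < e. *)
pose Q := \poly_(i < e) (B (insubd i0 i)).[0].@[v].
have Qx j : root Q (w.@[x j]).
  apply/eqP; rewrite horner_poly -[RHS](rootw j); apply: eq_bigr => i _.
  by rewrite valKd.
have Q0 : Q = 0.
  apply/eqP; apply: contraT => Qn0.
  have /(max_poly_roots Qn0) : all (root Q) (codom (fun j => w.@[x j])).
    by apply/allP => _ /codomP[j ->].
  rewrite map_inj_uniq ?enum_uniq // size_codom card_ord ltnNge size_poly.
  by move=> /(_ isT).
have /eqP := Bv; apply; have := coef_poly e (fun i => (B (insubd i0 i)).[0].@[v]) i1.
by rewrite ltn_ord valKd -/Q Q0 coef0.
Qed.

End Etale.

(** * Minimal polynomials *)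

(** A nonzero annihilator of least degree divides every other one, as otherwise
    the remainder would be an annihilator of smaller degree. *)
Lemma min_annihilator (F M : fieldType) (iota : {rmorphism F -> M}) (u : M)
    (p : {poly F}) : p != 0 -> root (map_poly iota p) u ->
  exists q : {poly F}, [/\ q \is monic, root (map_poly iota q) u &
    forall r, root (map_poly iota r) u -> q %| r].
Proof.
have [k] := ubnP (size p); elim: k p => // k IH p sp p0 pu.
case: (classic (exists r, root (map_poly iota r) u /\ ~~ (p %| r))) => [[r [ru]]|none].
  move=> pr; apply: (IH (r %% p)).
  - by apply: leq_trans (ltn_modpN0 r p0) _.
  - exact: pr.
  - have := ru; rewrite {1}(divp_eq r p) rmorphD rmorphM !rootE hornerD hornerM.
    by rewrite (eqP pu) mulr0 add0r.
exists ((lead_coef p)^-1 *: p); split.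
- by rewrite monicE lead_coefZ mulVf // lead_coef_eq0.
- by rewrite rootE map_polyZ hornerZ (eqP pu) mulr0.
move=> r ru; rewrite dvdpZl ?invr_eq0 ?lead_coef_eq0 //.
by apply/negPn/negP => pr; apply: none; exists r.
Qed.

Section MinimalPolynomial.

Variables (F M : fieldType) (iota : {rmorphism F -> M}) (u : M) (q : {poly F}).
Hypotheses (q_monic : q \is monic) (qu : root (map_poly iota q) u).
Hypothesis q_min : forall r, root (map_poly iota r) u -> q %| r.

(** Coprimality is stated by an identity because identities between coefficients
    survive when the coefficients are evaluated. *)
Lemma min_annihilator_bezout r : ~~ root (map_poly iota r) u ->
  exists s t, s * r + t * q = 1.
Proof.
move=> ru; have q0 : q != 0 by apply: monic_neq0.
have /Bezout_coprimepP[[s t] /=] : coprimep r q.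
  rewrite /coprimep; have /dvdpP[h] := dvdp_gcdr r q.
  have := dvdp_gcdl r q; move: (gcdp r q) => g gr qE.
  have : root (map_poly iota q) u by [].
  rewrite qE rmorphM rootM => /orP[/q_min qh|gu].
    have h0 : h != 0 by apply: contraNneq q0 => h0; rewrite qE h0 mul0r.
    have g0 : g != 0 by apply: contraNneq q0 => g0; rewrite qE g0 mulr0.
    have := dvdp_leq h0 qh; rewrite qE size_mul //.
    by move: h0 g0; rewrite -!size_poly_gt0; lia.
  case/negP: ru; have /dvdpP[k ->] := gr.
  by rewrite rmorphM rootM gu orbT.
rewrite -size_poly_eq1 => /size_poly1P[c c0 cE].
exists (c^-1 *: s), (c^-1 *: t); rewrite -!scalerAl -scalerDr cE.
by rewrite -mul_polyC -polyCM mulVf.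
Qed.

Lemma min_annihilator_separable : [pchar F] =i pred0 ->
  exists s t, s * q^`() + t * q = 1.
Proof.
move=> /pcharf0P F0; apply: min_annihilator_bezout; apply/negP => /q_min.
have q0 : q != 0 by apply: monic_neq0.
have s1 : (1 < size q)%N.
  by rewrite -(size_map_poly iota) (root_size_gt1 _ qu) // map_poly_eq0.
have q'0 : q^`() != 0.
  apply/eqP => /(congr1 (coefp (size q).-2)); rewrite /= coef_deriv coef0.
  have -> : (size q).-2.+1 = (size q).-1 by lia.
  rewrite -[q`__]/(lead_coef q) (monicP q_monic) => /eqP; rewrite F0; lia.
move=> /(dvdp_leq q'0); rewrite leqNgt => /negP; apply.
exact: lt_size_deriv.
Qed.

End MinimalPolynomial.

(** * The extension generated by the values of a rational map *)

Section FieldOfValues.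

Variables (L : fieldType) (L0 : [pchar L] =i pred0) (N : nat).
Local Notation P := {mpoly L[N]}.
Local Notation E := {fraction P}.

Lemma pchar_fraction_mpoly : [pchar E] =i pred0.
Proof.
move=> c; rewrite -(L0 c) !inE -(rmorph_nat (@constF L N)).
by rewrite tofrac_eq0 mpolyC_eq0.
Qed.

Variables (f : 'I_N -> E).
Hypothesis f_indep : injective (mmap (@constF L N) f).
Local Notation iota := (fraclift f_indep).

(** The [N] fractions [f_i] and [w] satisfy a polynomial relation; read as a
    polynomial in [w], it is nonzero over [L(f)] because the [f_i] are independent. *)
Lemma algebraic_over_values (w : E) :
  exists2 p : {poly E}, p != 0 & root (map_poly iota p) w.
Proof.
have := @algebraic_dependence L N (option 'I_N) (oapp f w).
rewrite card_option card_ord => /(_ (leqnn _))[D [lam [[m0 lam0] rel]]].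
pose mon (m : {ffun option 'I_N -> 'I_D}) := [multinom (m (Some i) : nat) | i < N].
pose p : {poly P} := \sum_m (lam m *: 'X_[mon m]) *: 'X^(m None).
have p0 : p != 0.
  suff pE : (p`_(m0 None))@_(mon m0) = lam m0.
    by apply: contraNneq lam0 => p0; rewrite -pE p0 coef0 mcoeff0.
  rewrite coef_sum raddf_sum (bigD1 m0) //= coefZ coefXn eqxx mulr1.
  rewrite mcoeffZ mcoeffX eqxx mulr1 big1 ?addr0 // => m mm0.
  rewrite coefZ coefXn; case: eqP => [eqN|]; rewrite ?mulr0 ?mcoeff0 // mulr1.
  rewrite mcoeffZ mcoeffX; case: eqP => [eqS|]; rewrite ?mulr0 //.
  case/eqP: mm0; apply/ffunP => -[i|]; apply: val_inj => //=.
  by move/mnmP/(_ i): eqS; rewrite !mnmE.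
exists (map_poly (@FracField.tofrac _) p).
  by rewrite map_poly_eq0_id0 // tofrac_eq0 lead_coef_eq0.
rewrite rootE -map_poly_comp /= -rel /p raddf_sum /= horner_sum.
apply/eqP; apply: eq_bigr => m _.
rewrite map_polyZ map_polyXn hornerZ hornerXn /= fraclift_tofrac.
rewrite /= mmapZ mmapX -mulrA; congr (_ * _).
rewrite (bigD1 None) //= mulrC; congr (_ * _).
rewrite (reindex_omap Some id) => [|[]//].
apply: eq_big => [i|i _]; first by rewrite eqxx.
by rewrite mnmE.
Qed.

(** The coordinates are adjoined one at a time.  The generator given by the
    primitive element theorem is an integral combination of the new coordinate and
    of the previous generator, so it remains a polynomial, which has a value at
    every point. *)
Lemma primitive_element :
  exists U : P, forall i, exists q, (map_poly iota q).[U%:F] = ('X_i)%:F.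
Proof.
have step k : exists U : P, forall i : 'I_N, (i < k)%N ->
    exists q, (map_poly iota q).[U%:F] = ('X_i)%:F; last first.
  by have [U UP] := step N; exists U => i; apply: UP.
elim: k => [|k [U UP]]; first by exists 0.
case: (ltnP k N) => [kN|Nk]; last first.
  by exists U => i _; apply: UP; apply: leq_trans Nk.
have [p p0 pU] := algebraic_over_values U%:F.
have [q q0 qX] := algebraic_over_values ('X_(Ordinal kN))%:F.
have [n [[g gU] [h hX]]] := pchar0_PET p0 pU q0 qX pchar_fraction_mpoly.
exists ('X_(Ordinal kN) *+ n - U) => i; rewrite ltnS leq_eqVlt tofracB tofracMn.
case/orP => [/eqP ik|/UP[r <-]].
  by exists h; rewrite hX; congr (('X_ _)%:F); apply: val_inj.
by exists (r \Po g); rewrite map_comp_poly horner_comp gU.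
Qed.

End FieldOfValues.

(** Finitely many polynomials have finitely many denominators; [d] is the product
    of all of them. *)
Lemma generic_values (L : fieldType) N (I : finType)
    (p : I -> {poly {fraction {mpoly L[N]}}}) :
  exists2 d : {mpoly L[N]}, d != 0 & forall y : 'I_N -> L, d.@[y] != 0 ->
    exists q : I -> {poly L}, forall i, fracval_poly (meval y) (p i) (q i).
Proof.
pose den (z : {fraction {mpoly L[N]}}) := \d_(repr z).
pose num (z : {fraction {mpoly L[N]}}) := \n_(repr z).
exists (\prod_i \prod_(k < size (p i)) den (p i)`_k).
  by apply/prodf_neq0 => i _; apply/prodf_neq0 => k _; apply: denom_ratioP.
move=> y dy.
exists (fun i => \poly_(k < size (p i)) ((num (p i)`_k).@[y] / (den (p i)`_k).@[y])).
move=> i k; rewrite coef_poly; case: ltnP => [ki|/leq_sizeP->//]; last exact: fracval0.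
exists (num (p i)`_k), (den (p i)`_k); split=> //; last exact: fraction_repr.
apply: contraNneq dy => dy0; rewrite (bigD1 i) //= (bigD1 (Ordinal ki)) //=.
by rewrite !mevalM dy0 !mul0r.
Qed.

Lemma generic_value (L : fieldType) N (p : {poly {fraction {mpoly L[N]}}}) :
  exists2 d : {mpoly L[N]}, d != 0 & forall y : 'I_N -> L, d.@[y] != 0 ->
    exists q : {poly L}, fracval_poly (meval y) p q.
Proof.
have [d d0 dP] := generic_values (fun _ : 'I_1 => p).
by exists d => // y /dP[q /(_ ord0)]; exists (q ord0).
Qed.

(** * The generic fibre *)

Lemma horner_map_polyB (F M : fieldType) (g : {rmorphism F -> M}) p q z :
  (map_poly g (p - q)).[z] = (map_poly g p).[z] - (map_poly g q).[z].
Proof. by rewrite rmorphB hornerD hornerN. Qed.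

Lemma horner_map_polyM (F M : fieldType) (g : {rmorphism F -> M}) p q z :
  (map_poly g (p * q)).[z] = (map_poly g p).[z] * (map_poly g q).[z].
Proof. by rewrite rmorphM hornerM. Qed.

Section GenericFibre.

Variables (L : closedFieldType) (L0 : [pchar L] =i pred0) (N : nat).
Local Notation P := {mpoly L[N]}.
Local Notation E := {fraction P}.

Variables (dom : pred 'rV[L]_N) (fL : 'rV[L]_N -> 'rV[L]_N) (f : 'I_N -> E).
Hypothesis f_val : forall x, dom x ->
  forall i, fracval (meval (x 0)) (f i) (fL x 0 i).
Variable q : P.
Hypotheses (q0 : q != 0) (dom_open : forall x : 'rV[L]_N, q.@[x 0] != 0 -> dom x).

Variables (e : nat) (y0 : 'I_N -> L) (x0 : 'I_e.+1 -> 'I_N -> L) (w : P).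
Hypotheses (x0_etale : forall j, etale f (x0 j) y0)
  (w_inj : injective (fun j => w.@[x0 j])).

Lemma values_independent : injective (mmap (@constF L N) f).
Proof.
apply: raddf_inj => a a0.
have inj1 : injective (fun j : 'I_1 => w.@[x0 ord0]) by move=> i j _; rewrite !ord1.
apply: (etale_independence L0 (fun=> x0_etale ord0) inj1 (a := fun=> a) _ ord0).
by rewrite big_ord1 expr0 mulr1.
Qed.

Local Notation iota := (fraclift values_independent).

Lemma lift_val (x : 'rV[L]_N) z v : dom x ->
  fracval (meval (fL x 0)) z v -> fracval (meval (x 0)) (iota z) v.
Proof.
move=> xd [n [d [d0 -> ->]]].
have ev a : fracval (meval (x 0)) (iota a%:F) (a.@[fL x 0]).
  rewrite fraclift_tofrac; apply: fracval_mmap => [c|]; last exact: f_val.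
  by have := fracval_tofrac (meval (x 0)) c%:MP; rewrite /= mevalC.
by rewrite fmorph_div; apply: fracvalM (ev n) (fracvalV (ev d) d0).
Qed.

Lemma lift_poly_val (x : 'rV[L]_N) p p' : dom x ->
  fracval_poly (meval (fL x 0)) p p' ->
  fracval_poly (meval (x 0)) (map_poly iota p) p'.
Proof. by move=> xd pp' i; rewrite coef_map; apply: lift_val. Qed.

(** If [M] had degree at most [e], the [e.+1] powers [1, w, ..., w ^ e] would be
    linearly dependent over [L(f)], since modulo [M] they are polynomials of
    degree less than [e] in [u].  After clearing denominators this is excluded by
    [etale_independence]. *)
Lemma degree_lower_bound (M : {poly E}) (u : E) (r : 'I_N -> {poly E}) :
  M \is monic -> root (map_poly iota M) u ->
  (forall a, (map_poly iota (mmap (polyC \o @constF L N) r a)).[u] = a%:F) ->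
  (e < (size M).-1)%N.
Proof.
move=> /monic_neq0 M0 Mu polyF; rewrite ltnNge; apply/negP => Me.
pose W i := mmap (polyC \o @constF L N) r w ^+ i %% M.
have [|lam [[i0 lam0] rel]] :=
  @linear_dependence E 'I_e.+1 'I_(size M).-1 (fun i k => (W i)`_k).
  by rewrite !card_ord ltnS.
have W_val i : (map_poly iota (W i)).[u] = w%:F ^+ i.
  have := congr1 (fun h => (map_poly iota h).[u])
    (divp_eq (mmap (polyC \o @constF L N) r w ^+ i) M).
  rewrite -/(W i) rmorphD rmorphM rmorphXn hornerD hornerM horner_exp polyF.
  by rewrite (eqP Mu) mulr0 add0r => ->.
have relW : \sum_i lam i *: W i = 0.
  apply/polyP => k; rewrite coef0 coef_sum.
  case: (ltnP k (size M).-1) => [kM|Mk].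
    by rewrite -[RHS](rel (Ordinal kM)); apply: eq_bigr => i _; rewrite coefZ.
  rewrite big1 // => i _; rewrite coefZ nth_default ?mulr0 //.
  by apply: leq_trans Mk; rewrite -ltnS prednK ?size_poly_gt0 // ltn_modp.
have relw : \sum_i iota (lam i) * w%:F ^+ i = 0.
  transitivity ((map_poly iota (\sum_i lam i *: W i)).[u]).
    rewrite raddf_sum horner_sum; apply: eq_bigr => i _.
    by rewrite /= map_polyZ hornerZ W_val.
  by rewrite relW rmorph0 horner0.
have /fin_all_exists[n /fin_all_exists[d nd]] := fun i => fraction_numden (lam i).
pose a i := n i * \prod_(k | k != i) d k.
have rela : \sum_i mmap (@constF L N) f (a i) * w%:F ^+ i = 0.
  have zE : iota (\prod_k d k)%:F * \sum_i iota (lam i) * w%:F ^+ i = 0.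
    by rewrite relw mulr0.
  rewrite -[RHS]zE.
  rewrite mulr_sumr; apply: eq_bigr => i _; rewrite mulrA; congr (_ * _).
  have [di0 ->] := nd i.
  rewrite -rmorphM (bigD1 i) //= tofracM mulrC mulrA divfK ?tofrac_eq0 //.
  by rewrite -tofracM fraclift_tofrac.
have := etale_independence L0 x0_etale w_inj rela i0.
move/eqP; rewrite mulf_eq0 => /orP[/eqP n0|].
  by case/eqP: lam0; have [_ ->] := nd i0; rewrite n0 tofrac0 mul0r.
by apply/negP/prodf_neq0 => k _; have [] := nd k.
Qed.

(** What makes the fibre over [y] correspond to the roots of the minimal polynomial
    [M] are identities between polynomials over [L(f)]: a Bezout relation between
    [M] and its derivative (the roots are simple), one between [M] and the
    polynomial expressing [q] and the denominators of [f] (the points obtained from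
    the roots lie in the domain), and the divisibility by [M] of the polynomials
    expressing [U - u] and the equations of the fibre.  They persist after
    evaluation at every [y] where all coefficients are defined. *)
Theorem generic_fibre_count :
  exists d, (e < d)%N /\ exists2 D : P, D != 0 &
    forall y : 'rV[L]_N, D.@[y 0] != 0 ->
    exists s : seq 'rV[L]_N,
      [/\ uniq s, size s = d & forall x, (x \in s) = dom x && (fL x == y)].
Proof.
have E0 := pchar_fraction_mpoly L0 N.
have [U /fin_all_exists[r rX]] := primitive_element L0 values_independent.
have [p p0 pU] := algebraic_over_values values_independent U%:F.
have [M [M_monic MU M_min]] := min_annihilator p0 pU.
have M0 : M != 0 := monic_neq0 M_monic.
have [s1 [t1 sep]] := min_annihilator_separable M_monic MU M_min E0.
have polyF (a : P) : (map_poly iota (mmap (polyC \o @constF L N) r a)).[U%:F] = a%:F.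
  rewrite -horner_evalE !rmorph_mmap -[in RHS](mmap_mpolyC a) rmorph_mmap.
  apply: eq_mmap => [c|i] /=; rewrite horner_evalE //.
  by rewrite map_polyC hornerC /= fraclift_tofrac /= mmapC.
(* The fractions f i in the coordinates, and the product of their denominators. *)
have /fin_all_exists[fn /fin_all_exists[fd fnd]] := fun i => fraction_numden (f i).
have fd0 i : fd i != 0 by have [] := fnd i.
have fE i : f i = (fn i)%:F / (fd i)%:F by have [] := fnd i.
pose dens := \prod_i fd i.
have dens0 : dens != 0 by apply/prodf_neq0 => i _; apply: fd0.
have /(min_annihilator_bezout M_monic MU M_min)[s2 [t2 bez]] :
    ~~ root (map_poly iota (mmap (polyC \o @constF L N) r (q * dens))) U%:F.
  by rewrite rootE polyF tofrac_eq0 mulf_neq0.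
have /M_min/dvdpP[kU kUE] :
    root (map_poly iota (mmap (polyC \o @constF L N) r U - 'X)) U%:F.
  by rewrite rootE horner_map_polyB map_polyX hornerX polyF subrr eqxx.
have /fin_all_exists[kf kfE] : forall i, exists k,
    mmap (polyC \o @constF L N) r ((fn i)) -
    (('X_i)%:F)%:P * mmap (polyC \o @constF L N) r ((fd i)) = k * M.
  move=> i; apply/dvdpP/M_min; rewrite rootE horner_map_polyB horner_map_polyM.
  have := polyF (fd i); have := polyF (fn i).
  move: (mmap _ r (fn i)) (mmap _ r (fd i)) => A B -> ->.
  rewrite map_polyC hornerC /= fraclift_tofrac /= mmapX mmap1U.
  have fdF0 : (fd i)%:F != 0 by rewrite tofrac_eq0.
  by rewrite fE (divfK fdF0) subrr eqxx.
(* All coefficients that occur in the identities are defined where D1, ..., D8 do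
   not vanish. *)
have [D1 D10 D1P] := generic_value M.
have [D2 D20 D2P] := generic_value s1.
have [D3 D30 D3P] := generic_value t1.
have [D4 D40 D4P] := generic_value s2.
have [D5 D50 D5P] := generic_value t2.
have [D6 D60 D6P] := generic_value kU.
have [D7 D70 D7P] := generic_values r.
have [D8 D80 D8P] := generic_values kf.
exists (size M).-1; split.
  exact: (degree_lower_bound M_monic MU polyF).
exists (D1 * (D2 * (D3 * (D4 * (D5 * (D6 * (D7 * D8))))))).
  by rewrite !mulf_neq0.
move=> y; rewrite !mevalM !mulf_eq0 !negb_or.
case/and5P => /D1P[m My] /D2P[s1' s1y] /D3P[t1' t1y] /D4P[s2' s2y].
case/and4P => /D5P[t2' t2y] /D6P[kU' kUy] /D7P[r' rP] /D8P[k' kP].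
have polyy a : fracval_poly (meval (y 0)) (mmap (polyC \o @constF L N) r a)
    (mmap (@polyC L) r' a).
  apply: fracval_poly_mmap => // c; apply: fracval_polyC.
  by have := fracval_tofrac (meval (y 0)) c%:MP; rewrite /= mevalC.
have polyyE a b : (mmap (@polyC L) r' a).[b] = a.@[fun i => (r' i).[b]].
  rewrite -horner_evalE rmorph_mmap; apply: eq_mmap => [c|i] //=.
  by rewrite horner_evalE hornerC.
have one_val : fracval_poly (meval (y 0)) 1 1.
  by rewrite -!polyC1; apply/fracval_polyC/fracval1.
have m_lead : m`_(size M).-1 = 1.
  apply: (fracval_uniq (My _)); rewrite -[M`__]/(lead_coef M) (monicP M_monic).
  exact: fracval1.
have size_m : size m = size M.
  have M1 : (0 < size M)%N by rewrite size_poly_gt0.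
  apply/eqP; rewrite eqn_leq; apply/andP; split.
    apply/leq_sizeP => k Mk; apply: (fracval_uniq (My k)).
    by rewrite nth_default //; apply: fracval0.
  rewrite leqNgt; apply/negP => mM; have := m_lead; rewrite nth_default.
    by move/eqP; rewrite eq_sym oner_eq0.
  by rewrite -ltnS prednK.
have m_monic : m \is monic by rewrite monicE /lead_coef size_m m_lead.
have [rs mE] := closed_field_poly_normal m.
rewrite (monicP m_monic) scale1r in mE.
have rs_uniq : uniq rs.
  rewrite -separable_prod_XsubC -mE unlock; apply/Bezout_coprimepP.
  exists (t1', s1') => /=; rewrite addrC.
  suff -> : s1' * m^`() + t1' * m = 1 by exact: eqpxx.
  apply: fracval_poly_uniq one_val; rewrite -sep.
  by apply: fracval_polyD (fracval_polyM s1y _) (fracval_polyM t1y My);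
     apply: fracval_poly_deriv.
have mem_rs b : (b \in rs) = root m b by rewrite mE root_prod_XsubC.
(* The point of the fibre that corresponds to the root b. *)
pose pt b : 'rV[L]_N := \row_i (r' i).[b].
have ptE a b : a.@[pt b 0] = (mmap (@polyC L) r' a).[b].
  by rewrite polyyE; apply: meval_eq => i; rewrite mxE.
(* The primitive element takes the value b there, so distinct roots give distinct
   points. *)
have U_pt b : root m b -> U.@[pt b 0] = b.
  move=> mb; have : mmap (@polyC L) r' U - 'X = kU' * m.
    apply: (fracval_poly_uniq _ (fracval_polyM kUy My)); rewrite -kUE.
    exact: fracval_polyB (polyy _) (fracval_polyX _).
  move/(congr1 (horner^~ b)); rewrite !hornerE (eqP mb) mulr0 -ptE => /eqP.
  by rewrite subr_eq0 => /eqP.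
have pt_fibre b : root m b -> dom (pt b) && (fL (pt b) == y).
  move=> mb.
  have : s2' * mmap (@polyC L) r' (q * dens) + t2' * m = 1.
    apply: fracval_poly_uniq one_val; rewrite -bez.
    exact: fracval_polyD (fracval_polyM s2y (polyy _)) (fracval_polyM t2y My).
  move/(congr1 (horner^~ b)); rewrite !hornerE (eqP mb) mulr0 addr0 -ptE => unit.
  have : (q * dens).@[pt b 0] != 0.
    by apply: contraTneq (oner_neq0 L) => qd0; rewrite -unit qd0 mulr0 eqxx.
  rewrite mevalM mulf_eq0 negb_or => /andP[/dom_open dpt densb].
  rewrite dpt; apply/eqP/rowP => i.
  have db : ((fd i)).@[pt b 0] != 0.
    apply: contraNneq densb => d0; rewrite /dens (bigD1 i) //= mevalM d0 mul0r.
    by [].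
  apply: (fracval_uniq (f_val dpt i)); rewrite fE.
  exists ((fn i)), ((fd i)); split=> //.
  apply: (canRL (mulfK db)).
  have : mmap (@polyC L) r' ((fn i)) -
      (y 0 i)%:P * mmap (@polyC L) r' ((fd i)) = k' i * m.
    apply: (fracval_poly_uniq _ (fracval_polyM (kP i) My)); rewrite -kfE.
    apply: fracval_polyB (polyy _) (fracval_polyM _ (polyy _)).
    apply: fracval_polyC; have := fracval_tofrac (meval (y 0)) 'X_i.
    by rewrite /= mevalXU.
  move/(congr1 (horner^~ b)); rewrite !hornerE (eqP mb) mulr0 -!ptE => /eqP.
  by rewrite subr_eq0 => /eqP nE; apply: etrans (esym nE) _.
exists (map pt rs); split.
- rewrite map_inj_in_uniq // => b c; rewrite !mem_rs => mb mc bc.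
  by rewrite -(U_pt b) // bc U_pt.
- by rewrite size_map -size_m mE size_prod_XsubC.
move=> x; apply/mapP/idP => [[b bs ->]|/andP[xd /eqP xy]].
  by apply: pt_fibre; rewrite -mem_rs.
have U_val : fracval (meval (x 0)) U%:F (U.@[x 0]) := fracval_tofrac (meval (x 0)) U.
exists (U.@[x 0]).
  rewrite mem_rs; apply/eqP; apply: (fracval_uniq _ (fracval0 (meval (x 0)))).
  rewrite -(eqP MU); apply: fracval_horner => //; apply: lift_poly_val => //.
  by rewrite xy.
apply/rowP => i; rewrite mxE.
have Xi : fracval (meval (x 0)) ('X_i)%:F (x 0 i).
  by have := fracval_tofrac (meval (x 0)) 'X_i; rewrite /= mevalXU.
apply: (fracval_uniq Xi); rewrite -rX; apply: fracval_horner => //.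
by apply: lift_poly_val => //; rewrite xy.
Qed.

End GenericFibre.

(** * Evaluation of matrices and quadruples of fractions *)

Section MatrixValue.

Variables (R : idomainType) (M : fieldType) (phi : {rmorphism R -> M}).
Local Notation T := {fraction R}.

Definition mxval p q (Z : 'M[T]_(p, q)) (V : 'M[M]_(p, q)) : Prop :=
  forall i j, fracval phi (Z i j) (V i j).

Lemma mxvalD p q (Z W : 'M[T]_(p, q)) V U :
  mxval Z V -> mxval W U -> mxval (Z + W) (V + U).
Proof. by move=> ZV WU i j; rewrite !mxE; apply: fracvalD. Qed.

Lemma mxvalB p q (Z W : 'M[T]_(p, q)) V U :
  mxval Z V -> mxval W U -> mxval (Z - W) (V - U).
Proof. by move=> ZV WU i j; rewrite !mxE; apply: fracvalB. Qed.

Lemma mxvalZ p q z v (Z : 'M[T]_(p, q)) V :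
  fracval phi z v -> mxval Z V -> mxval (z *: Z) (v *: V).
Proof. by move=> zv ZV i j; rewrite !mxE; apply: fracvalM. Qed.

Lemma mxvalM p q r (Z : 'M[T]_(p, q)) (W : 'M_(q, r)) V U :
  mxval Z V -> mxval W U -> mxval (Z *m W) (V *m U).
Proof.
by move=> ZV WU i j; rewrite !mxE; apply: fracval_sum => k _; apply: fracvalM.
Qed.

Lemma fracval_sign k : fracval phi ((-1) ^+ k) ((-1) ^+ k).
Proof. by apply/fracvalX/fracvalN/fracval1. Qed.

Lemma mxval_det p (Z : 'M[T]_p) V : mxval Z V -> fracval phi (\det Z) (\det V).
Proof.
move=> ZV; apply: fracval_sum => s _; apply: fracvalM; first exact: fracval_sign.
by apply: fracval_prod.
Qed.

Lemma mxval_unitmx p (Z : 'M[T]_p) V : mxval Z V -> V \in unitmx -> Z \in unitmx.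
Proof.
by move=> /mxval_det ZV; rewrite !unitmxE !unitfE => /(fracval_neq0 ZV).
Qed.

Lemma mxvalV p (Z : 'M[T]_p) V :
  mxval Z V -> V \in unitmx -> mxval (invmx Z) (invmx V).
Proof.
move=> ZV Vu; have Zu := mxval_unitmx ZV Vu; rewrite /invmx Zu Vu.
apply: mxvalZ; first by apply: fracvalV; rewrite -?unitfE //; exact: mxval_det.
move=> i j; rewrite !mxE; apply: fracvalM; first exact: fracval_sign.
by apply: mxval_det => k l; rewrite !mxE.
Qed.

Lemma mxval_C n (Y X : 'M[T]_n) y x :
  mxval Y y -> mxval X x -> C_dom y x -> C_dom Y X /\ mxval (C Y X) (C y x).
Proof.
move=> Yy Xx d; have g := mxvalB Yy Xx; split; first exact: mxval_unitmx g d.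
by apply: mxvalM; [apply: mxvalM | apply: mxvalV].
Qed.

Definition quadval n (Z : quad T n) (V : quad M n) : Prop :=
  let: (a, b, c, d) := Z in let: (a', b', c', d') := V in
  [/\ mxval a a', mxval b b', mxval c c' & mxval d d'].

Lemma quadval_F n (Z : quad T n) V :
  quadval Z V -> F_dom V -> F_dom Z /\ quadval (F Z) (F V).
Proof.
case: Z V => [[[a b] c] d] [[[a' b'] c'] d'] [aV bV cV dV] /and5P[].
move=> /(mxval_C bV aV)[d1 v1] /(mxval_C aV cV)[d2 v2] /(mxval_C aV bV)[d3 v3].
move=> /(mxval_C v2 v3)[d4 v4] /and4P[] /(mxval_C bV dV)[d5 v5] /(mxval_C bV cV)[d6 v6].
move=> /(mxval_C v5 v6)[d7 v7] /(mxval_C cV dV)[d8 v8].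
split; last exact: And4 v1 v4 v7 v8.
apply/and5P; split; [exact: d1 | exact: d2 | exact: d3 | exact: d4 |].
by apply/and4P; split; [exact: d5 | exact: d6 | exact: d7 | exact: d8].
Qed.

End MatrixValue.

Section QuadVector.

Variable n : nat.

Definition qrow (R : Type) (q : quad R n) : 'rV[R]_(qdim n) :=
  let: (a, b, c, d) := q in
  row_mx (row_mx (row_mx (mxvec a) (mxvec b)) (mxvec c)) (mxvec d).

Definition rowq (R : Type) (v : 'rV[R]_(qdim n)) : quad R n :=
  (vec_mx (lsubmx (lsubmx (lsubmx v))), vec_mx (rsubmx (lsubmx (lsubmx v))),
   vec_mx (rsubmx (lsubmx v)), vec_mx (rsubmx v)).

Lemma qrowE (R : Type) (q : quad R n) : qcoord q = qrow q ord0.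
Proof. by case: q => [[[a b] c] d]. Qed.

Lemma qrowK (R : Type) : cancel (@qrow R) (@rowq R).
Proof.
by case=> [[[a b] c] d]; rewrite /rowq /= !(row_mxKl, row_mxKr) !mxvecK.
Qed.

Lemma rowqK (R : Type) : cancel (@rowq R) (@qrow R).
Proof. by move=> v; rewrite /rowq /qrow !vec_mxK !hsubmxK. Qed.

Lemma mxval_rowq (R : idomainType) (M : fieldType) (phi : {rmorphism R -> M})
    (v : 'rV_(qdim n)) (w : 'rV_(qdim n)) :
  mxval phi v w -> quadval phi (rowq v) (rowq w).
Proof. by move=> vw; split=> i j; rewrite !mxE; apply: vw. Qed.

Lemma quadval_qrow (R : idomainType) (M : fieldType) (phi : {rmorphism R -> M})
    (Z : quad _ n) (V : quad _ n) :
  quadval phi Z V -> mxval phi (qrow Z) (qrow V).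
Proof.
have row_val p q (A : 'rV_p) (B : 'rV_q) A' B' : mxval phi A A' -> mxval phi B B' ->
    mxval phi (row_mx A B) (row_mx A' B').
  by move=> AA BB i j; rewrite !mxE; case: splitP => k _.
have vec_val (A : 'M_n) A' : mxval phi A A' -> mxval phi (mxvec A) (mxvec A').
  by move=> AA i k; case/mxvec_indexP: k => k l; rewrite ord1 !mxvecE.
case: Z V => [[[a b] c] d] [[[a' b'] c'] d'] [aV bV cV dV].
by apply: row_val (row_val _ _ _ _ _ _ (row_val _ _ _ _ _ _ _ _) _) _; apply: vec_val.
Qed.

End QuadVector.

(** * The derivative of F along arcs *)

(* Closes matrix equalities that hold by linearity in the products they contain. *)
Ltac mxlinear :=
  repeat match goal with |- context [?A *m ?B] =>
    let m := fresh "m" in set m := A *m B; clearbody m end;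
  apply/matrixP => ? ?; rewrite !mxE; ring.

Section Derivative.

Variables (R : comUnitRingType) (n : nat).

(** The derivative of [C] at [(y, x)] in the direction [(y1, x1)], solved from the
    derivative of the identity [C y x * (y - x) = (y - x) * x]. *)
Definition dC (y x y1 x1 : 'M[R]_n) : 'M[R]_n :=
  ((y - x) *m x1 + (y1 - x1) *m x - C y x *m (y1 - x1)) *m invmx (y - x).

Lemma dCE (y x y1 x1 : 'M[R]_n) : C_dom y x ->
  dC y x y1 x1 *m (y - x) + C y x *m (y1 - x1) = (y - x) *m x1 + (y1 - x1) *m x.
Proof. by move=> d; rewrite /dC mulmxKV // subrK. Qed.

Lemma CE (y x : 'M[R]_n) : C_dom y x -> C y x *m (y - x) = (y - x) *m x.
Proof. by move=> d; rewrite /C mulmxKV. Qed.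

Definition dF (q q1 : quad R n) : quad R n :=
  let: (a, b, c, d) := q in let: (a1, b1, c1, d1) := q1 in
  (dC b a b1 a1,
   dC (C a c) (C a b) (dC a c a1 c1) (dC a b a1 b1),
   dC (C b d) (C b c) (dC b d b1 d1) (dC b c b1 c1),
   dC c d c1 d1).

Lemma dC_linear k (y x y1 x1 y2 x2 : 'M[R]_n) :
  dC y x (k *: y1 + y2) (k *: x1 + x2) = k *: dC y x y1 x1 + dC y x y2 x2.
Proof.
rewrite /dC scalemxAl -mulmxDl; congr (_ *m _).
rewrite !(mulmxDl, mulmxDr, mulmxN, mulNmx) -!scalemxAl -!scalemxAr.
by mxlinear.
Qed.

End Derivative.

(** When [g] and [x] move and [c0] does not, the defect of [c0 g = g x] is exactly
    [t] times an expression in which the terms of order two are kept. *)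
Lemma first_order_conj (K : comNzRingType) n (t : K) (c0 g0 x0 g1 x1 : 'M[K]_n) :
  c0 *m g0 = g0 *m x0 ->
  (g0 + t *: g1) *m (x0 + t *: x1) =
  c0 *m (g0 + t *: g1) +
  t *: (g0 *m x1 + g1 *m (x0 + t *: x1) - c0 *m g1).
Proof.
move=> base; rewrite !(mulmxDl, mulmxDr, =^~ scalemxAl, =^~ scalemxAr) base.
by mxlinear.
Qed.

Section Jet.

Variables (L : fieldType).
Local Notation T := {fraction {poly L}}.
Local Notation tT := ('X : {poly L})%:F.
Local Notation ev0 := (horner_eval (0 : L)).

(** [Z = A + t A1] up to terms that vanish to order two at [t = 0]; the remainder
    stays inside [G], which only has to be defined at [t = 0]. *)
Definition mxjet p q (Z : 'M[T]_(p, q)) (A A1 : 'M[L]_(p, q)) : Prop :=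
  exists2 G, Z = map_mx (@constT L) A + tT *: G & mxval ev0 G A1.

Lemma map_constT_val p q (A : 'M[L]_(p, q)) : mxval ev0 (map_mx (@constT L) A) A.
Proof. by move=> i j; rewrite mxE; apply: constT_val. Qed.

Lemma mxjet_val p q (Z : 'M[T]_(p, q)) A A1 : mxjet Z A A1 -> mxval ev0 Z A.
Proof.
case=> G -> GA; have := mxvalD (map_constT_val A) (mxvalZ (tT_val L) GA).
by rewrite scale0r addr0.
Qed.

(** The remainder is the formula of [dC] in which some factors are kept over [L(t)]
    so that [C Y X = C y x + t G] holds exactly; its value at [t = 0] is then read
    off factor by factor. *)
Lemma mxjet_C n (Y X : 'M[T]_n) y y1 x x1 :
  mxjet Y y y1 -> mxjet X x x1 -> C_dom y x ->
  mxjet (C Y X) (C y x) (dC y x y1 x1).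
Proof.
move=> Yj Xj d; have [D _] := mxval_C (mxjet_val Yj) (mxjet_val Xj) d.
have gval := mxvalB (mxjet_val Yj) (mxjet_val Xj).
case: Yj => Y1 YE Y1v; case: Xj => X1 XE X1v.
pose G := ((map_mx (@constT L) (y - x)) *m X1 + (Y1 - X1) *m X
  - map_mx (@constT L) (C y x) *m (Y1 - X1))
  *m invmx (Y - X).
exists G; last first.
  apply: mxvalM; last exact: mxvalV.
  apply: mxvalB; last by apply: mxvalM; [apply: map_constT_val | apply: mxvalB].
  apply: mxvalD; first by apply: mxvalM; [apply: map_constT_val | ].
  apply: mxvalM; first exact: mxvalB.
  by apply: mxjet_val; exists X1; [exact: XE | exact: X1v].
apply: (canLR (mulmxK D)); rewrite [RHS]mulmxDl -[(tT *: G) *m _]scalemxAl mulmxKV //.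
have gE : Y - X = map_mx (@constT L) (y - x) + tT *: (Y1 - X1).
  by rewrite YE XE map_mxB scalerBr opprD addrACA.
have base : map_mx (@constT L) (C y x) *m map_mx (@constT L) (y - x) =
    map_mx (@constT L) (y - x) *m map_mx (@constT L) x.
  by rewrite -!map_mxM CE.
by rewrite gE XE (first_order_conj _ _ _ base).
Qed.

Definition quadjet n (Z : quad T n) (q q1 : quad L n) : Prop :=
  let: (a, b, c, d) := Z in let: (a', b', c', d') := q in
  let: (a1, b1, c1, d1) := q1 in
  [/\ mxjet a a' a1, mxjet b b' b1, mxjet c c' c1 & mxjet d d' d1].

Lemma quadjet_F n (Z : quad T n) q q1 :
  quadjet Z q q1 -> F_dom q -> quadjet (F Z) (F q) (dF q q1).
Proof.
case: Z q q1 => [[[a b] c] d] [[[a' b'] c'] d'] [[[a1 b1] c1] d1] [aj bj cj dj].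
case/and5P => /(mxjet_C bj aj) j1 /(mxjet_C aj cj) j2 /(mxjet_C aj bj) j3.
move=> /(mxjet_C j2 j3) j4 /and4P[] /(mxjet_C bj dj) j5 /(mxjet_C bj cj) j6.
move=> /(mxjet_C j5 j6) j7 /(mxjet_C cj dj) j8.
exact: And4 j1 j4 j7 j8.
Qed.

End Jet.

(** * The map F over the field of rational functions *)

(** The open set is where the numerator of the determinant does not vanish. *)
Lemma unitmx_open (L : fieldType) N p (Z : 'M[{fraction {mpoly L[N]}}]_p) :
  Z \in unitmx -> exists2 q : {mpoly L[N]}, q != 0 &
    forall x V, q.@[x] != 0 -> mxval (meval x) Z V -> V \in unitmx.
Proof.
rewrite unitmxE unitfE => Z0; have [m [d [d0 ZE]]] := fraction_numden (\det Z).
exists m.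
  by apply: contraNneq Z0 => m0; rewrite ZE m0 tofrac0 mul0r.
move=> x V mx /mxval_det ZV; rewrite unitmxE unitfE.
apply: contraNneq mx => V0; rewrite V0 in ZV.
have := fracvalM ZV (fracval_tofrac (meval x) d).
rewrite ZE divfK ?tofrac_eq0 // mul0r => mv.
by rewrite -(fracval_uniq mv (fracval_tofrac (meval x) m)).
Qed.

Section QuadMap.

Variables (L : fieldType) (n : nat).
Local Notation N := (qdim n).
Local Notation E := {fraction {mpoly L[N]}}.
Local Notation T := {fraction {poly L}}.
Local Notation tT := ('X : {poly L})%:F.

Definition generic_quad : quad E n := rowq (\row_i ('X_i)%:F).
Definition generic_F (i : 'I_N) : E := qrow (F generic_quad) 0 i.

Lemma generic_quad_val (M : fieldType) (phi : {rmorphism {mpoly L[N]} -> M})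
    (x : 'rV[M]_N) :
  (forall i, phi 'X_i = x 0 i) -> quadval phi generic_quad (rowq x).
Proof.
move=> phiX; apply: mxval_rowq => i j; rewrite mxE ord1 -phiX.
exact: fracval_tofrac.
Qed.

Lemma generic_F_val (M : fieldType) (phi : {rmorphism {mpoly L[N]} -> M})
    (x : 'rV[M]_N) :
  (forall i, phi 'X_i = x 0 i) -> F_dom (rowq x) ->
  forall i, fracval phi (generic_F i) (qrow (F (rowq x)) 0 i).
Proof.
move=> phiX xd i; have [_ /quadval_qrow Fv] := quadval_F (generic_quad_val phiX) xd.
exact: Fv.
Qed.

Lemma F_dom_open (x0 : quad L n) : F_dom x0 ->
  exists2 q : {mpoly L[N]}, q != 0 &
    forall x : 'rV[L]_N, q.@[x 0] != 0 -> F_dom (rowq x).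
Proof.
rewrite -[x0]qrowK => x0d.
have gv (x : 'rV[L]_N) : quadval (meval (x 0)) generic_quad (rowq x).
  by apply: generic_quad_val => i; apply: mevalXU.
have [] := quadval_F (gv (qrow x0)) x0d.
case: generic_quad gv => [[[a b] c] d] gv.
case/and5P => /unitmx_open[q1 q10 u1] /unitmx_open[q2 q20 u2] /unitmx_open[q3 q30 u3].
move=> /unitmx_open[q4 q40 u4] /and4P[] /unitmx_open[q5 q50 u5] /unitmx_open[q6 q60 u6].
move=> /unitmx_open[q7 q70 u7] /unitmx_open[q8 q80 u8] _.
exists (q1 * (q2 * (q3 * (q4 * (q5 * (q6 * (q7 * q8))))))).
  by rewrite !mulf_neq0.
move=> x; rewrite !mevalM !mulf_eq0 !negb_or.
case/and5P => x1 x2 x3 x4 /and4P[x5 x6 x7 x8].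
have := gv x; rewrite /rowq; move: (vec_mx _) (vec_mx _) (vec_mx _) (vec_mx _).
move=> d' c' b' a' [av bv cv dv].
have d1 : C_dom b' a' by exact: u1 _ _ x1 (mxvalB bv av).
have d2 : C_dom a' c' by exact: u2 _ _ x2 (mxvalB av cv).
have d3 : C_dom a' b' by exact: u3 _ _ x3 (mxvalB av bv).
have [_ v2] := mxval_C av cv d2; have [_ v3] := mxval_C av bv d3.
have d4 : C_dom (C a' c') (C a' b') by exact: u4 _ _ x4 (mxvalB v2 v3).
have d5 : C_dom b' d' by exact: u5 _ _ x5 (mxvalB bv dv).
have d6 : C_dom b' c' by exact: u6 _ _ x6 (mxvalB bv cv).
have [_ v5] := mxval_C bv dv d5; have [_ v6] := mxval_C bv cv d6.
have d7 : C_dom (C b' d') (C b' c') by exact: u7 _ _ x7 (mxvalB v5 v6).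
have d8 : C_dom c' d' by exact: u8 _ _ x8 (mxvalB cv dv).
by rewrite /F_dom d1 d2 d3 d4 d5 d6 d7 d8.
Qed.

Lemma mxjet_rowq (Z : 'rV[T]_N) (q q1 : 'rV[L]_N) :
  mxjet Z q q1 -> quadjet (rowq Z) (rowq q) (rowq q1).
Proof.
case=> G -> Gv; split; [pose H := vec_mx (lsubmx (lsubmx (lsubmx G))) |
  pose H := vec_mx (rsubmx (lsubmx (lsubmx G))) |
  pose H := vec_mx (rsubmx (lsubmx G)) | pose H := vec_mx (rsubmx G)];
  exists H; by [apply/matrixP => i j; rewrite !mxE |
    move=> i j; rewrite !mxE; apply: Gv].
Qed.

Lemma quadjet_qrow (Z : quad T n) q q1 :
  quadjet Z q q1 -> mxjet (qrow Z) (qrow q) (qrow q1).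
Proof.
have row_jet k l (A : 'rV[T]_k) (B : 'rV[T]_l) a b a1 b1 :
    mxjet A a a1 -> mxjet B b b1 -> mxjet (row_mx A B) (row_mx a b) (row_mx a1 b1).
  move=> [G -> Gv] [H -> Hv]; exists (row_mx G H).
    by rewrite map_row_mx scale_row_mx add_row_mx.
  by move=> i j; rewrite !mxE; case: splitP => m _.
have vec_jet (A : 'M[T]_n) a a1 : mxjet A a a1 -> mxjet (mxvec A) (mxvec a) (mxvec a1).
  move=> [G -> Gv]; exists (mxvec G); first by rewrite map_mxvec -linearZ -linearD.
  by move=> i k; case/mxvec_indexP: k => k l; rewrite ord1 !mxvecE.
case: Z q q1 => [[[a b] c] d] [[[a' b'] c'] d'] [[[a1 b1] c1] d1] [aj bj cj dj].
rewrite /qrow; apply: (@row_jet _ (n * n)); last exact: vec_jet.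
apply: (@row_jet _ (n * n)); last exact: vec_jet.
by apply: (@row_jet (n * n) (n * n)); apply: vec_jet.
Qed.

Lemma quadjet_val (Z : quad T n) q q1 :
  quadjet Z q q1 -> quadval (horner_eval 0) Z q.
Proof.
case: Z q q1 => [[[a b] c] d] [[[a' b'] c'] d'] [[[a1 b1] c1] d1] [aj bj cj dj].
exact: And4 (mxjet_val aj) (mxjet_val bj) (mxjet_val cj) (mxjet_val dj).
Qed.

(** The arcs are the lines [x0 + t s]: the velocity of their image at [t = 0] is
    [dF x0 s]. *)
Lemma dF_surjective_etale (x0 : quad L n) : F_dom x0 ->
  (forall v, exists s, dF x0 s = v) ->
  etale generic_F (qrow x0 0) (qrow (F x0) 0).
Proof.
move=> x0d surj v; have [s sE] := surj (rowq (\row_i v i)).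
pose Z := map_mx (@constT L) (qrow x0) + tT *: map_mx (@constT L) (qrow s).
have Zj : mxjet Z (qrow x0) (qrow s).
  by exists (map_mx (@constT L) (qrow s)) => //; apply: map_constT_val.
have Zqj := mxjet_rowq Zj; rewrite !qrowK in Zqj.
have [Zd _] := quadval_F (quadjet_val Zqj) x0d.
have [G FE Gv] := quadjet_qrow (quadjet_F Zqj x0d).
exists (Z 0), (fun k => qrow (F (rowq Z)) 0 k), (fun k => G 0 k) => k; split.
- exact: mxjet_val Zj 0 k.
- apply: (generic_F_val (phi := mmap (@constT L) (Z 0))) => // i.
  by rewrite /= mmapX mmap1U.
- by rewrite FE !mxE.
- by have := Gv 0 k; rewrite sE rowqK mxE.
Qed.

End QuadMap.

Section DerivativeSurjective.

Variables (L : fieldType) (n : nat) (x : quad L n).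
Local Notation N := (qdim n).

Let dFrow (v : 'rV[L]_N) : 'rV[L]_N := qrow (dF x (rowq v)).

Let dFrow_linear : linear dFrow.
Proof.
move=> k u v; rewrite /dFrow /rowq !linearP.
case: x => [[[a b] c] d] /=; rewrite !dC_linear /qrow !linearP.
by rewrite !(scale_row_mx, add_row_mx).
Qed.

HB.instance Definition _ :=
  GRing.isLinear.Build L 'rV[L]_N 'rV[L]_N *:%R dFrow dFrow_linear.

Lemma dF_injective_surjective :
  (forall s, dF x s = (0, 0, 0, 0) -> s = (0, 0, 0, 0)) ->
  forall v, exists s, dF x s = v.
Proof.
move=> inj v; pose M := lin1_mx dFrow.
have q0 : qrow (0, 0, 0, 0 : 'M[L]_n) = 0.
  by rewrite /qrow !linear0 !row_mx0.
have Mu : M \in unitmx.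
  rewrite -row_free_unit -kermx_eq0; apply/rowV0P => u /sub_kermxP.
  rewrite mul_rV_lin1 /= => /(congr1 (@rowq n L)); rewrite qrowK -q0 qrowK.
  by move=> /inj; rewrite -{2}[u]rowqK => ->.
exists (rowq (qrow v *m invmx M)); apply: (can_inj (@qrowK n L)).
by rewrite -[LHS](mul_rV_lin1 dFrow) -/M mulmxKV.
Qed.

End DerivativeSurjective.

(** The polynomial that takes distinct values at the points [x j] is a coordinate. *)
Theorem F_degree_lower_bound (L : closedFieldType) (L0 : [pchar L] =i pred0)
    (n e : nat) (x : 'I_e.+1 -> quad L n) (y : quad L n) (i0 : 'I_(qdim n)) :
  (forall j, F_dom (x j)) -> (forall j, F (x j) = y) ->
  injective (fun j => qcoord (x j) i0) ->
  (forall j s, dF (x j) s = (0, 0, 0, 0) -> s = (0, 0, 0, 0)) ->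
  exists2 d : nat, has_geometric_degree (@F_dom L n) (@F L n) d & (e < d)%N.
Proof.
move=> xd xy x_inj dFx.
have [q q0 q_dom] := F_dom_open (xd ord0).
have et j : etale (@generic_F L n) (qrow (x j) 0) (qrow y 0).
  rewrite -(xy j).
  exact: dF_surjective_etale (xd j) (dF_injective_surjective (dFx j)).
have w_inj : injective (fun j => ('X_i0 : {mpoly L[_]}).@[qrow (x j) 0]).
  by move=> i j; rewrite !mevalXU -!qrowE; apply: x_inj.
pose fL (v : 'rV[L]_(qdim n)) := qrow (F (rowq v)).
have f_val (v : 'rV[L]_(qdim n)) : F_dom (rowq v) ->
    forall i, fracval (meval (v 0)) (generic_F L i) (fL v 0 i).
  by move=> vd i; apply: generic_F_val => // k; apply: mevalXU.
have [d [ed [D D0 DP]]] := generic_fibre_count L0 (dom := fun v => F_dom (rowq v))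
  f_val q0 q_dom et w_inj.
exists d => //; exists D => // z Dz.
have [|s [us sd sP]] := DP (qrow z); first by move: Dz; rewrite qrowE.
exists (map (@rowq n L) s); split.
- by rewrite map_inj_uniq //; apply: can_inj (@rowqK n L).
- by rewrite size_map.
move=> u; rewrite -{1}[u](@qrowK n L) mem_map ?sP; last exact: can_inj (@rowqK n L).
by rewrite /fL !(@qrowK n L u) (inj_eq (can_inj (@qrowK n L))).
Qed.

(** * Points with a of square zero and b, d involutions *)

(* Expands noncommutative products of matrices before comparing them. *)
Ltac mxring :=
  rewrite !(mulmxDl, mulmxDr, mulmxN, mulNmx, opprD, opprK, mulmxA, mul1mx,
    mulmx1, mul0mx, mulmx0); mxlinear.

(** A noncommutative identity that follows from equations [e_i = 0] is proved by
    giving [z] as an explicit combination of terms [P e_i Q]; the next lemmas build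
    such combinations. *)
Lemma eq_by_zero (V : zmodType) (z x y : V) : z = 0 -> x - y = z -> x = y.
Proof. by move=> -> /eqP; rewrite subr_eq0 => /eqP. Qed.

Lemma eq_sub0 (V : zmodType) (x y : V) : x = y -> x - y = 0.
Proof. by move=> ->; rewrite subrr. Qed.

Lemma add_zero (V : zmodType) (x y : V) : x = 0 -> y = 0 -> x + y = 0.
Proof. by move=> -> ->; rewrite addr0. Qed.

Lemma opp_zero (V : zmodType) (x : V) : x = 0 -> - x = 0.
Proof. by move=> ->; rewrite oppr0. Qed.

Lemma mull_zero (R : pzRingType) p q r (P : 'M[R]_(p, q)) (x : 'M_(q, r)) :
  x = 0 -> P *m x = 0.
Proof. by move=> ->; rewrite mulmx0. Qed.

Lemma mulr_zero (R : pzRingType) p q r (P : 'M[R]_(q, r)) (x : 'M_(p, q)) :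
  x = 0 -> x *m P = 0.
Proof. by move=> ->; rewrite mul0mx. Qed.

Section ConjugationAlgebra.

Variables (K : fieldType) (n : nat).
Implicit Types x y a b c d m g : 'M[K]_n.

Lemma unitmx_mulIl g x : g \in unitmx -> x *m g = 0 -> x = 0.
Proof. by move=> gu xg; rewrite -(mulmxK gu x) xg mul0mx. Qed.

Lemma unitmx_mulIr g x : g \in unitmx -> g *m x = 0 -> x = 0.
Proof. by move=> gu gx; rewrite -(mulKmx gu x) gx mulmx0. Qed.

Lemma C_unique y x z : C_dom y x -> z *m (y - x) = (y - x) *m x -> C y x = z.
Proof. by move=> d e; rewrite /C -e mulmxK. Qed.

(** A conjugate of a square root of a scalar is again one, so [C0 * C0 = s].
    Differentiating [C0 ^ 2 (y - x) = (y - x) x ^ 2], the two terms in [y1 - x1]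
    cancel because both squares are the scalar [s]. *)
Lemma dC_anticomm y x y1 x1 s : C_dom y x -> x *m x = s%:M ->
  let C0 := C y x in let C1 := dC y x y1 x1 in
  (C0 *m C1 + C1 *m C0) *m (y - x) = (y - x) *m (x *m x1 + x1 *m x).
Proof.
move=> dom xx C0 C1.
have e0 : C0 *m (y - x) = (y - x) *m x by apply: CE.
have e1 := dCE y1 x1 dom; rewrite -/C0 -/C1 in e1.
have CC : C0 *m C0 = s%:M.
  apply: (can_inj (mulmxK dom)).
  by rewrite /= -mulmxA e0 mulmxA e0 -mulmxA xx scalar_mxC.
have z2 : C0 *m C0 *m (y1 - x1) - (y1 - x1) *m (x *m x) = 0.
  by rewrite CC xx scalar_mxC subrr.
move: e0 e1 z2 => /eq_sub0 z0 /eq_sub0 z1 z2; clearbody C0 C1.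
apply: (eq_by_zero (add_zero (add_zero (mull_zero C0 z1) (mulr_zero x z1))
  (add_zero (add_zero (mull_zero C1 z0) (mulr_zero x1 z0)) (opp_zero z2)))).
by mxring.
Qed.

Lemma dC_zero_anticomm y x y1 x1 s : C_dom y x -> x *m x = s%:M ->
  C y x *m dC y x y1 x1 + dC y x y1 x1 *m C y x = 0 -> x *m x1 + x1 *m x = 0.
Proof.
move=> dom xx z; apply: (unitmx_mulIr dom).
by rewrite -(dC_anticomm y1 x1 dom xx) z mul0mx.
Qed.

End ConjugationAlgebra.

Lemma C_square (K : fieldType) n (y x : 'M[K]_n) s :
  C_dom y x -> x *m x = s%:M -> C y x *m C y x = s%:M.
Proof.
move=> dom xx; apply: (can_inj (mulmxK dom)).
by rewrite /= -mulmxA CE // mulmxA CE // -mulmxA xx scalar_mxC.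
Qed.

(** First-order part of the composition of two conjugations: if [z] is constant and
    [z = u l u^-1], [l = h x h^-1] hold to first order, then so does
    [z = (u h) x (u h)^-1]. *)
Lemma jet_conj_comp (K : fieldType) n (z u u1 l l1 h h1 x x1 : 'M[K]_n) :
  z *m u = u *m l -> z *m u1 = u *m l1 + u1 *m l ->
  l *m h = h *m x -> l1 *m h + l *m h1 = h *m x1 + h1 *m x ->
  z *m (u1 *m h + u *m h1) = (u1 *m h + u *m h1) *m x + u *m h *m x1.
Proof.
move=> /eq_sub0 e0 /eq_sub0 e1 /eq_sub0 f0 /eq_sub0 f1.
apply: (eq_by_zero (add_zero (add_zero (mulr_zero h1 e0) (mulr_zero h e1))
  (add_zero (mull_zero u1 f0) (mull_zero u f1)))).
by mxring.
Qed.

(** The hypotheses are the derivatives, along a tangent vector with [c1 = 0], of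
    the equations [C b a = A], [C a c = m] and [B G = G b] with [A] and [B] constant.
    Here [G = m a - m b - a b + b b] is [(C a c - C a b) (a - b)], and its derivative
    is [G1] because [b b1 + b1 b = 0].  The left triple [a, b, c] and the right
    triple [a', b', c'] are the same at a point; they are separated so that the
    off-diagonal blocks of [b1] at a block diagonal point obey the same
    definition. *)
Definition rigid (K : fieldType) p q (a b c m A B : 'M[K]_p) (a' b' c' : 'M[K]_q) :=
  forall b1 a1 m1 : 'M[K]_(p, q),
  b *m b1 + b1 *m b' = 0 ->
  a1 = (b - a) *m (A *m b1 - b1 *m a') ->
  m1 *m (a' - c') = a1 *m c' - m *m a1 ->
  let G1 := m1 *m (a' - b') + m *m a1 - a1 *m b' - (m + a) *m b1 in
  B *m G1 = G1 *m b' + (m *m a - m *m b - a *m b + b *m b) *m b1 ->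
  b1 = 0.

Section InvolutivePoint.

Variables (K : fieldType) (n : nat) (a b c d m A B : 'M[K]_n).
Let G := m *m a - m *m b - a *m b + b *m b.
Hypotheses (aa : a *m a = 0) (bb : b *m b = 1%:M) (dd : d *m d = 1%:M).
Hypotheses (dom_ba : C_dom b a) (dom_ac : C_dom a c) (dom_ab : C_dom a b)
  (dom_bd : C_dom b d) (dom_bc : C_dom b c) (dom_cd : C_dom c d).
Hypotheses (AE : A *m (b - a) = (b - a) *m a) (mE : m *m (a - c) = (a - c) *m c).
Hypotheses (G_unit : G \in unitmx) (GE : B *m G = G *m b).
Hypothesis c_unit : c *m c - 1%:M \in unitmx.

Let l := C a b.
Let j := C b c.

Let Cba : C b a = A. Proof. exact: C_unique. Qed.
Let Cac : C a c = m. Proof. exact: C_unique. Qed.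

Let Cbd : C b d = - b.
Proof.
apply: C_unique => //; apply: (eq_by_zero (add_zero (eq_sub0 dd)
  (opp_zero (eq_sub0 bb)))).
by mxring.
Qed.

Let lE : l *m (a - b) = (a - b) *m b. Proof. exact: CE. Qed.
Let jE : j *m (b - c) = (b - c) *m c. Proof. exact: CE. Qed.

Let GmE : (m - l) *m (a - b) = G.
Proof.
apply: (eq_by_zero (opp_zero (eq_sub0 lE))).
by rewrite /G; mxring.
Qed.

Let dom_ml : C_dom m l.
Proof. by move: G_unit; rewrite -GmE unitmx_mul => /andP[]. Qed.

Let Cml : C m l = B.
Proof.
apply: C_unique => //; apply: (can_inj (mulmxK dom_ab)).
by rewrite /= -[LHS]mulmxA GmE GE -[RHS]mulmxA lE mulmxA GmE.
Qed.

Let GkE : (- b - j) *m (b - c) = c *m c - 1%:M.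
Proof.
apply: (eq_by_zero (add_zero (opp_zero (eq_sub0 jE))
  (opp_zero (eq_sub0 bb)))).
by mxring.
Qed.

Let dom_kj : C_dom (- b) j.
Proof. by move: c_unit; rewrite -GkE unitmx_mul => /andP[]. Qed.

Let Ckj : C (- b) j = c.
Proof.
apply: C_unique => //; apply: (can_inj (mulmxK dom_bc)).
rewrite /= -[LHS]mulmxA GkE -[RHS]mulmxA jE mulmxA GkE.
by mxring.
Qed.

Lemma involutive_F_dom : F_dom (a, b, c, d).
Proof.
by rewrite /F_dom dom_ba dom_ac dom_ab dom_bd dom_bc dom_cd Cac Cbd dom_ml dom_kj.
Qed.

(** As [C b d = - b], the third component is the conjugate of [j = C b c] by
    [- b - j], that is, the conjugate of [c] by [(- b - j) (b - c) = c ^ 2 - 1],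
    which commutes with [c]. *)
Lemma involutive_F_value : F (a, b, c, d) = (A, B, c, C c d).
Proof. by rewrite /F Cba Cac Cbd Cml Ckj. Qed.

(** Anticommutation passes from the components of [F] to [a1], [b1] and [d1] by
    [dC_zero_anticomm].  Then the third component gives [c1 = 0], the fourth
    [d1 = 0], and [b1] is killed by [rigid]. *)
Lemma involutive_dF_injective : rigid a b c m A B a b c ->
  forall s, dF (a, b, c, d) s = (0, 0, 0, 0) -> s = (0, 0, 0, 0).
Proof.
move=> rig [[[a1 b1] c1] d1] /=; rewrite Cac Cbd -/l -/j.
set m1 := dC a c a1 c1; set l1 := dC a b a1 b1.
set k1 := dC b d b1 d1; set j1 := dC b c b1 c1.
case=> z1 z2 z3 z4.
have a0 : a *m a = 0%:M by rewrite aa raddf0.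
have za : a *m a1 + a1 *m a = 0.
  by apply: (dC_zero_anticomm dom_ba a0 (y1 := b1)); rewrite z1 mulmx0 mul0mx addr0.
have zl : l *m l1 + l1 *m l = 0.
  apply: (dC_zero_anticomm dom_ml (C_square dom_ab bb) (y1 := m1)).
  by rewrite z2 mulmx0 mul0mx addr0.
have zb : b *m b1 + b1 *m b = 0 by apply: (dC_zero_anticomm dom_ab bb zl).
have zd : d *m d1 + d1 *m d = 0.
  by apply: (dC_zero_anticomm dom_cd dd (y1 := c1)); rewrite z4 mulmx0 mul0mx addr0.
have k1E : k1 = - b1.
  have := dCE b1 d1 dom_bd; rewrite -/k1 Cbd => /eq_sub0 e.
  apply/eqP; rewrite -addr_eq0; apply/eqP/(unitmx_mulIl dom_bd).
  apply: (eq_by_zero (add_zero e (add_zero zb (opp_zero zd)))).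
  by mxring.
have c10 : c1 = 0.
  have e3 := dCE k1 j1 dom_kj; rewrite Ckj z3 mul0mx add0r in e3.
  have e3' : c *m (- b - j) = (- b - j) *m j by rewrite -{1}Ckj CE.
  have ej := dCE b1 c1 dom_bc; rewrite -/j -/j1 in ej.
  have := jet_conj_comp e3' e3 jE ej; rewrite GkE.
  have -> : (k1 - j1) *m (b - c) + (- b - j) *m (b1 - c1) = c *m c1 + c1 *m c.
    apply: (eq_by_zero (add_zero (opp_zero (eq_sub0 ej))
      (opp_zero zb))).
    by rewrite k1E; mxring.
  move=> /eq_sub0 e; apply: (unitmx_mulIl c_unit).
  apply: (eq_by_zero (opp_zero e)).
  by mxring.
have d10 : d1 = 0.
  have D_unit : (C c d + c) *m (c - d) \in unitmx.
    suff -> : (C c d + c) *m (c - d) = c *m c - 1%:M by [].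
    apply: (eq_by_zero (add_zero (eq_sub0 (CE dom_cd))
      (opp_zero (eq_sub0 dd)))).
    by mxring.
  have := dCE c1 d1 dom_cd; rewrite z4 c10 => /eq_sub0 e.
  move: D_unit; rewrite unitmx_mul => /andP[Du _].
  apply: (unitmx_mulIr Du).
  apply: (eq_by_zero (add_zero zd (opp_zero e))).
  by mxring.
have a1E : a1 = (b - a) *m (A *m b1 - b1 *m a).
  have inv : (b - a) *m (A + b) = 1%:M.
    apply: mulmx1C; apply: (eq_by_zero (add_zero (eq_sub0 AE)
      (add_zero (eq_sub0 bb) (opp_zero aa)))).
    by mxring.
  rewrite -[LHS]mul1mx -inv -mulmxA; congr (_ *m _).
  have := dCE b1 a1 dom_ba; rewrite Cba z1 => /eq_sub0 e.
  apply: (eq_by_zero (add_zero za (opp_zero e))).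
  by mxring.
have b10 : b1 = 0.
  apply: (rig b1 a1 m1 zb a1E).
    have := dCE a1 c1 dom_ac; rewrite -/m1 Cac c10 => /eq_sub0 e.
    by apply: (eq_by_zero e); mxring.
  have e2 := dCE m1 l1 dom_ml; rewrite Cml z2 mul0mx add0r in e2.
  have e2' : B *m (m - l) = (m - l) *m l by rewrite -{1}Cml CE.
  have el := dCE a1 b1 dom_ab; rewrite -/l -/l1 in el.
  have := jet_conj_comp e2' e2 lE el; rewrite GmE.
  have -> // : (m1 - l1) *m (a - b) + (m - l) *m (a1 - b1) =
      m1 *m (a - b) + m *m a1 - a1 *m b - (m + a) *m b1.
  apply: (eq_by_zero (add_zero (opp_zero (eq_sub0 el)) zb)).
  by mxring.
by rewrite a1E b10 c10 d10 mulmx0 mul0mx subrr mulmx0.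
Qed.

End InvolutivePoint.

(** * Block sums with scalar matrices *)

Ltac expand_products :=
  rewrite !(mulmxDl, mulmxDr, mulmxN, mulNmx, opprD, opprK, mulmxA).

Section ScalarBlocks.

Variables (K : fieldType).

(** A matrix [E] with one nonzero entry satisfies [x%:M *m E = E *m x%:M], so the
    equations for [b1] give those for [b1 *m E], which keeps one column of [b1] and
    has two columns: the 2 by 2 case suffices for every [k]. *)
Lemma rigid_scalar_right p k (a b c m A B : 'M[K]_p) (x y z : K) :
  rigid a b c m A B (x%:M : 'M_2) y%:M z%:M ->
  rigid a b c m A B (x%:M : 'M_k) y%:M z%:M.
Proof.
move=> rig b1 a1 m1 e1 e2 e3 G1 e5; apply/matrixP => r i.
pose E : 'M[K]_(k, 2) := delta_mx i 0.
have cE (M : 'M[K]_(p, k)) s : M *m E *m s%:M = M *m s%:M *m E.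
  by rewrite -!mulmxA mul_scalar_mx mul_mx_scalar.
suff : b1 *m E = 0.
  move/matrixP/(_ r 0); rewrite !mxE (bigD1 i) //= mxE !eqxx mulr1 big1 ?addr0 //.
  by move=> k' /negbTE ki; rewrite mxE ki mulr0.
apply: (rig (b1 *m E) (a1 *m E) (m1 *m E)).
- apply: (eq_by_zero (mulr_zero E e1)); rewrite cE; by mxring.
- apply: (eq_by_zero (mulr_zero E (eq_sub0 e2))).
  by expand_products; rewrite !cE; mxlinear.
- apply: (eq_by_zero (mulr_zero E (eq_sub0 e3))).
  by expand_products; rewrite !cE; mxlinear.
apply: (eq_by_zero (mulr_zero E (eq_sub0 e5))); rewrite /G1.
by expand_products; rewrite !cE; mxlinear.
Qed.

Lemma rigid_scalar_left q k (x y z u v w : K) (a b c : 'M[K]_q) :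
  rigid (x%:M : 'M_2) y%:M z%:M u%:M v%:M w%:M a b c ->
  rigid (x%:M : 'M_k) y%:M z%:M u%:M v%:M w%:M a b c.
Proof.
move=> rig b1 a1 m1 e1 e2 e3 G1 e5; apply/matrixP => i r.
pose E : 'M[K]_(2, k) := delta_mx 0 i.
have cE p (M : 'M[K]_(p, 2)) s : M *m s%:M *m E = M *m E *m s%:M.
  by rewrite -!mulmxA mul_scalar_mx mul_mx_scalar.
have cE1 s : s%:M *m E = E *m s%:M by rewrite mul_scalar_mx mul_mx_scalar.
suff : E *m b1 = 0.
  move/matrixP/(_ 0 r); rewrite !mxE (bigD1 i) //= mxE !eqxx mul1r big1 ?addr0 //.
  by move=> k' /negbTE ki; rewrite mxE ki andbF mul0r.
apply: (rig (E *m b1) (E *m a1) (E *m m1)).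
- apply: (eq_by_zero (mull_zero E e1)).
  by expand_products; rewrite ?(cE, cE1); mxlinear.
- apply: (eq_by_zero (mull_zero E (eq_sub0 e2))).
  by expand_products; rewrite ?(cE, cE1); mxlinear.
- apply: (eq_by_zero (mull_zero E (eq_sub0 e3))).
  by expand_products; rewrite ?(cE, cE1); mxlinear.
apply: (eq_by_zero (mull_zero E (eq_sub0 e5))); rewrite /G1.
by expand_products; rewrite ?(cE, cE1); mxlinear.
Qed.

Variables (p k : nat).

Definition blk (X : 'M[K]_p) (x : K) : 'M[K]_(p + k) := block_mx X 0 0 x%:M.

Lemma blkB X x Y y : blk X x - blk Y y = blk (X - Y) (x - y).
Proof.
by rewrite /blk opp_block_mx add_block_mx !oppr0 !addr0 raddfB.
Qed.

Lemma blkD X x Y y : blk X x + blk Y y = blk (X + Y) (x + y).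
Proof. by rewrite /blk add_block_mx !addr0 raddfD. Qed.

Lemma blkM X x Y y : blk X x *m blk Y y = blk (X *m Y) (x * y).
Proof.
by rewrite /blk mulmx_block !mulmx0 !mul0mx !addr0 !add0r -scalar_mxM.
Qed.

Lemma blk1 : blk 1%:M 1 = 1%:M.
Proof. by rewrite /blk -scalar_mx_block. Qed.

Lemma blk_unitmx X x : X \in unitmx -> x != 0 -> blk X x \in unitmx.
Proof.
move=> Xu x0; rewrite unitmxE /blk det_ublock det_scalar unitrM -unitmxE Xu.
by rewrite unitfE expf_neq0.
Qed.

(** The equations split into those of the four blocks of [b1]; in the block where
    both sides are scalar they force [b1 = 0] directly. *)
Lemma rigid_blk (a b c m A B : 'M[K]_p) (g : K) : g != 0 -> g != 1 ->
  rigid a b c m A B a b c ->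
  rigid a b c m A B (0%:M : 'M_k) 1%:M g%:M ->
  rigid (0%:M : 'M_k) 1%:M g%:M g%:M 0%:M 1%:M a b c ->
  rigid (blk a 0) (blk b 1) (blk c g) (blk m g) (blk A 0) (blk B 1)
    (blk a 0) (blk b 1) (blk c g).
Proof.
move=> g0 g1 rpp rps rsp b1 a1 m1.
rewrite -[b1]submxK -[a1]submxK -[m1]submxK.
move: (ulsubmx b1) (ursubmx b1) (dlsubmx b1) (drsubmx b1) => U V W Z.
move: (ulsubmx a1) (ursubmx a1) (dlsubmx a1) (drsubmx a1) => aU aV aW aZ.
move: (ulsubmx m1) (ursubmx m1) (dlsubmx m1) (drsubmx m1) => mU mV mW mZ.
rewrite !(blkB, blkD, blkM) /blk.
rewrite !mulmx_block !(mulmx0, mul0mx, addr0, add0r).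
rewrite !(opp_block_mx, add_block_mx) !mulmx_block !(mulmx0, mul0mx, addr0, add0r).
rewrite /= -[in X in X -> _]block_mx0 add_block_mx.
move=> /eq_block_mx[e1U e1V e1W e1Z] /eq_block_mx[e2U e2V e2W e2Z].
move=> /eq_block_mx[e3U e3V e3W e3Z] /eq_block_mx[e5U e5V e5W e5Z].
have scalE (x y : K) : (x%:M - y%:M = (x - y)%:M :> 'M[K]_k) by rewrite raddfB.
have scalD (x y : K) : (x%:M + y%:M = (x + y)%:M :> 'M[K]_k) by rewrite raddfD.
have -> : U = 0 by apply: (rpp U aU mU).
have -> : V = 0.
  by apply: (rps V aV mV) => //; rewrite !scalE sub0r.
have -> : W = 0.
  apply: (rsp W aW mW) => //; first by rewrite scalE.
  by rewrite -!scalar_mxM !(scalE, scalD) addr0.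
have -> : Z = 0; last by rewrite block_mx0.
move: e2Z e3Z e5Z; rewrite !mul_mx_scalar !mul_scalar_mx !scale0r subrr scaler0 => ->.
rewrite !scaler0 subrr => /eqP; rewrite scaler_eq0 oppr_eq0 (negbTE g0) => /eqP ->.
rewrite !scaler0 !add0r !scale1r oppr0 !add0r => /eqP.
rewrite -subr_eq0 opprD addNKr oppr_eq0 scaler_eq0.
rewrite !mulr0 !mulr1 subr0 sub0r addrC subr_eq0 eq_sym (negbTE g1).
by move=> /eqP.
Qed.

End ScalarBlocks.

(** * Three points over one value *)

Definition mx2 (R : nzRingType) (p q r s : R) : 'M[R]_2 :=
  \matrix_(i, j) (if i == 0 then if j == 0 then p else q else if j == 0 then r else s).

Section TwoByTwo.

Variables (R : comNzRingType).

Lemma forall_ord2 (P : 'I_2 -> Prop) : P 0 -> P 1 -> forall i, P i.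
Proof.
move=> P0 P1 i; have [->|->] // : i = 0 \/ i = 1.
by case: i => [[|[|i]] ilt] //; [left | right]; apply: val_inj.
Qed.

Lemma mx2_ext (A B : 'M[R]_2) : A 0 0 = B 0 0 -> A 0 1 = B 0 1 ->
  A 1 0 = B 1 0 -> A 1 1 = B 1 1 -> A = B.
Proof. by move=> *; apply/matrixP; do 2!apply: forall_ord2. Qed.

Lemma mx2_eta (A : 'M[R]_2) : A = mx2 (A 0 0) (A 0 1) (A 1 0) (A 1 1).
Proof. by apply: mx2_ext; rewrite !mxE. Qed.

Lemma mx2_inj (p q r s p' q' r' s' : R) : mx2 p q r s = mx2 p' q' r' s' ->
  [/\ p = p', q = q', r = r' & s = s'].
Proof.
move/matrixP => e; have := (e 0 0, e 0 1, e 1 0, e 1 1).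
by rewrite !mxE /= => -[[[-> ->] ->] ->].
Qed.

Lemma mx2D (p q r s p' q' r' s' : R) :
  mx2 p q r s + mx2 p' q' r' s' = mx2 (p + p') (q + q') (r + r') (s + s').
Proof. by apply: mx2_ext; rewrite !mxE. Qed.

Lemma mx2N (p q r s : R) : - mx2 p q r s = mx2 (- p) (- q) (- r) (- s).
Proof. by apply: mx2_ext; rewrite !mxE. Qed.

Lemma mx2M (p q r s p' q' r' s' : R) :
  mx2 p q r s *m mx2 p' q' r' s' = mx2 (p * p' + q * r') (p * q' + q * s')
    (r * p' + s * r') (r * q' + s * s').
Proof.
by apply: mx2_ext; rewrite !mxE !big_ord_recl big_ord0 !mxE /= addr0.
Qed.

Lemma mx2_scalar (x : R) : x%:M = mx2 x 0 0 x.
Proof. by apply: mx2_ext; rewrite !mxE. Qed.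

Lemma mx2_zero : mx2 0 0 0 0 = 0 :> 'M[R]_2.
Proof. by apply: mx2_ext; rewrite !mxE. Qed.

Definition mx2E := (mx2D, mx2N, mx2M).

End TwoByTwo.

Lemma mx2_unitmx (K : fieldType) (p q r s det : K) :
  p * s - q * r = det -> det != 0 -> mx2 p q r s \in unitmx.
Proof.
move=> dE d0.
have inv : mx2 p q r s *m mx2 (s / det) (- q / det) (- r / det) (p / det) = 1%:M.
  by rewrite mx2M mx2_scalar -dE; congr mx2; field; rewrite dE.
by have [] := mulmx1_unit inv.
Qed.

(** Knowing the inverse [h] of [a' - c'] turns the equation for [m1] into a
    definition, so that the condition on [U] becomes an explicit linear system in
    its four entries. *)
Lemma rigid_by_inverse (K : fieldType) (a b c m A B a' b' c' h : 'M[K]_2) :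
  (a' - c') *m h = 1%:M ->
  (forall (u0 u1 u2 u3 : K) (a1 m1 G1 : 'M[K]_2), let U := mx2 u0 u1 u2 u3 in
    b *m U + U *m b' = mx2 0 0 0 0 ->
    a1 = (b - a) *m (A *m U - U *m a') ->
    m1 = (a1 *m c' - m *m a1) *m h ->
    G1 = m1 *m (a' - b') + m *m a1 - a1 *m b' - (m + a) *m U ->
    B *m G1 = G1 *m b' + (m *m a - m *m b - a *m b + b *m b) *m U ->
    U = mx2 0 0 0 0) ->
  rigid a b c m A B a' b' c'.
Proof.
move=> hE rig b1 a1 m1 e1 e2 e3 G1 e5; rewrite [b1]mx2_eta -mx2_zero.
have m1E : m1 = (a1 *m c' - m *m a1) *m h by rewrite -e3 -mulmxA hE mulmx1.
by apply: (rig _ _ _ _ a1 m1 G1); rewrite -?mx2_eta // mx2_zero.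
Qed.

Lemma scale_zero (R : pzRingType) (k x : R) : x = 0 -> k * x = 0.
Proof. by move=> ->; rewrite mulr0. Qed.

(* A_0 and B_0 are the common values of C b a and of the second component, c_0
   and d_0 the common c and d.  Once these are fixed, a^2 = 0, b^2 = 1 and the
   equations A_0 (b - a) = (b - a) a, B_0 G = G b form a polynomial system in a
   and b; a_i, b_i are three rational solutions, and m_i = C a_i c_0. *)
Local Notation A_0 := (mx2 0 1 0 0).
Local Notation B_0 := (mx2 (- 1) 0 0 1).
Local Notation c_0 := (mx2 2 1 (- 2) 0).
Local Notation d_0 := (mx2 1 0 (- 1) (- 1)).
Local Notation a_1 := (mx2 0 (- 1) 0 0).
Local Notation b_1 := (mx2 1 (- 6) 0 (- 1)).
Local Notation m_1 := (mx2 1 1 (- 1) 1).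
Local Notation a_2 := (mx2 (- 2) 1 (- 4) 2).
Local Notation b_2 := (mx2 (- 1) 0 (- 2) 1).
Local Notation m_2 := (mx2 3 (- 2) (5 / 2) (- 1)).
Local Notation a_3 := (mx2 (- 4 / 5) (- 1 / 5) (16 / 5) (4 / 5)).
Local Notation b_3 := (mx2 (1 / 5) (- 6 / 5) (- 4 / 5) (- 1 / 5)).
Local Notation m_3 := (mx2 3 1 (- 5) (- 1)).

Section Rigidity.

Variables (K : fieldType) (K_char0 : [pchar K] =i pred0).

Let K0 (n : nat) : (n%:R == 0 :> K) = (n == 0)%N.
Proof. by have /pcharf0P-> := K_char0. Qed.

Ltac entries := rewrite ?mx2E; congr mx2; field; rewrite ?K0.

(* Here u0, ..., u3 are the entries of b1 in the definition of rigid, and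
   e0, ..., e3 those of its first equation.  Below, a1, m1 and the matrix G1 are
   first written as linear forms in u0, ..., u3; each u_i is then a combination
   of e0, ..., e3 and of the entries e4, ..., e7 of the last equation. *)
Ltac rigid_entries h :=
  apply: (@rigid_by_inverse _ _ _ _ _ _ _ _ _ _ h) => [|u0 u1 u2 u3 a1 m1 G1 /=];
  rewrite ?mx2_scalar !mx2E; [by congr mx2; field; rewrite ?K0 |];
  move=> /mx2_inj[/eq_sub0 e0 /eq_sub0 e1 /eq_sub0 e2 /eq_sub0 e3] a1E m1E G1E e5.

Lemma rigid_first : @rigid K 2 2 a_1 b_1 c_0 m_1 A_0 B_0 a_1 b_1 c_0.
Proof.
rigid_entries (mx2 0 (1 / 2) (- 1 / 2) (- 1 / 2) : 'M[K]_2).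
have {}a1E : a1 = mx2 u2 (u0 - 5 * u2 + u3) 0 (- u2).
  by rewrite a1E; entries.
have {}m1E : m1 = mx2 (1 / 2 * u0 - 7 / 2 * u2 + 1 / 2 * u3)
    (- 1 / 2 * u0 + 2 * u2 - 1 / 2 * u3) (- 1 / 2 * u0 + 2 * u2 - 1 / 2 * u3)
    (- 1 / 2 * u0 + 7 / 2 * u2 - 1 / 2 * u3).
  by rewrite m1E a1E; entries.
have {}G1E : G1 = mx2 (- 3 / 2 * u0 + 7 / 2 * u2 - 1 / 2 * u3)
    (4 * u0 - u1 - 41 / 2 * u2 + 4 * u3) (3 / 2 * u0 - 4 * u2 + 1 / 2 * u3)
    (- 4 * u0 + u1 + 33 / 2 * u2 - 5 * u3).
  by rewrite G1E m1E a1E; entries.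
move: e5; rewrite G1E !mx2E =>
  /mx2_inj[/eq_sub0 e4 /eq_sub0 e5 /eq_sub0 e6 /eq_sub0 e7]; congr mx2.
- apply: (eq_by_zero (add_zero (add_zero (scale_zero (- 1 / 4) e3)
    (scale_zero (- 1 / 2) e4)) (scale_zero (- 5 / 2) e6))).
  by field; rewrite ?K0.
- apply: (eq_by_zero (add_zero (add_zero (scale_zero 4 e4)
    (scale_zero 13 e6)) (scale_zero 1 e7))).
  by field; rewrite ?K0.
- apply: (eq_by_zero (add_zero (add_zero (scale_zero (- 1 / 12) e3)
    (scale_zero (- 1 / 6) e4)) (scale_zero (- 1 / 2) e6))).
  by field; rewrite ?K0.
- apply: (eq_by_zero (add_zero (add_zero (scale_zero (1 / 4) e1) (scale_zero
    (- 1) e3)) (scale_zero (1 / 2) e4))).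
  by field; rewrite ?K0.
Qed.

Lemma rigid_first_right : @rigid K 2 2 a_1 b_1 c_0 m_1 A_0 B_0 0%:M 1%:M (- 2)%:M.
Proof.
rigid_entries (mx2 (1 / 2) 0 0 (1 / 2) : 'M[K]_2).
have {}a1E : a1 = mx2 u2 u3 0 0.
  by rewrite a1E; entries.
have {}m1E : m1 = mx2 (- 3 / 2 * u2) (- 3 / 2 * u3) (1 / 2 * u2) (1 / 2 * u3).
  by rewrite m1E a1E; entries.
have {}G1E : G1 = mx2 (- u0 + 3 / 2 * u2) (- u1 + 3 / 2 * u3)
    (u0 - 5 / 2 * u2) (u1 - 5 / 2 * u3).
  by rewrite G1E m1E a1E; entries.
move: e5; rewrite G1E !mx2E =>
  /mx2_inj[/eq_sub0 e4 /eq_sub0 e5 /eq_sub0 e6 /eq_sub0 e7]; congr mx2.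
- apply: (eq_by_zero (add_zero (scale_zero 2 e0) (scale_zero (- 3 / 2) e4))).
  by field; rewrite ?K0.
- apply: (eq_by_zero (add_zero (scale_zero 2 e1) (scale_zero (- 3 / 2) e5))).
  by field; rewrite ?K0.
- apply: (eq_by_zero (add_zero (scale_zero (- 1 / 2) e4) (scale_zero
    (- 1) e6))).
  by field; rewrite ?K0.
- apply: (eq_by_zero (add_zero (scale_zero (- 1 / 2) e5) (scale_zero
    (- 1) e7))).
  by field; rewrite ?K0.
Qed.

Lemma rigid_first_left :
  @rigid K 2 2 0%:M 1%:M (- 2)%:M (- 2)%:M 0%:M 1%:M a_1 b_1 c_0.
Proof.
rigid_entries (mx2 0 (1 / 2) (- 1 / 2) (- 1 / 2) : 'M[K]_2).
have {}a1E : a1 = mx2 0 u0 0 u2.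
  by rewrite a1E; entries.
have {}m1E : m1 = mx2 (- u0) (- 2 * u0) (- u2) (- 2 * u2).
  by rewrite m1E a1E; entries.
have {}G1E : G1 = mx2 (3 * u0) (- 8 * u0 + 2 * u1) (3 * u2)
    (- 8 * u2 + 2 * u3).
  by rewrite G1E m1E a1E; entries.
move: e5; rewrite G1E !mx2E =>
  /mx2_inj[/eq_sub0 e4 /eq_sub0 e5 /eq_sub0 e6 /eq_sub0 e7]; congr mx2.
- by apply: (eq_by_zero (scale_zero (1 / 2) e0)); field; rewrite ?K0.
- apply: (eq_by_zero (add_zero (scale_zero (- 1) e0) (scale_zero 1 e5))).
  by field; rewrite ?K0.
- by apply: (eq_by_zero (scale_zero (1 / 2) e2)); field; rewrite ?K0.
- apply: (eq_by_zero (add_zero (scale_zero (- 1) e2) (scale_zero 1 e7))).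
  by field; rewrite ?K0.
Qed.

Lemma rigid_second : @rigid K 2 2 a_2 b_2 c_0 m_2 A_0 B_0 a_2 b_2 c_0.
Proof.
rigid_entries (mx2 (- 1 / 4) 0 (- 1 / 4) (1 / 2) : 'M[K]_2).
have {}a1E : a1 = mx2 (2 * u0 + 4 * u1 - u2 - 4 * u3)
    (- u0 - 2 * u1 + u2 + 3 * u3) (4 * u0 + 8 * u1 - 4 * u3)
    (- 2 * u0 - 4 * u1 + u2 + 4 * u3).
  by rewrite a1E; entries.
have {}m1E : m1 = mx2 (- 9 / 4 * u0 - 9 / 2 * u1 + 3 / 4 * u2 + 15 / 4 * u3)
    (1 / 2 * u0 + u1 - u2 - 5 / 2 * u3)
    (- 31 / 8 * u0 - 31 / 4 * u1 + 1 / 4 * u2 + 35 / 8 * u3)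
    (9 / 4 * u0 + 9 / 2 * u1 - 3 / 4 * u2 - 15 / 4 * u3).
  by rewrite m1E a1E; entries.
have {}G1E : G1 = mx2 (- 7 / 4 * u0 - 3 / 2 * u1 + 1 / 4 * u2 - 3 / 4 * u3)
    (1 / 4 * u0 - 1 / 2 * u1 - 1 / 4 * u2 + 1 / 4 * u3)
    (15 / 8 * u0 + 3 / 4 * u1 - 1 / 4 * u2 + 9 / 8 * u3)
    (- 1 / 8 * u0 + 5 / 4 * u1 - 7 / 8 * u3).
  by rewrite G1E m1E a1E; entries.
move: e5; rewrite G1E !mx2E =>
  /mx2_inj[/eq_sub0 e4 /eq_sub0 e5 /eq_sub0 e6 /eq_sub0 e7]; congr mx2.
- apply: (eq_by_zero (add_zero (add_zero (add_zero (scale_zero (1 / 2) e0)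
    (scale_zero (4 / 3) e5)) (scale_zero (2 / 3) e6)) (scale_zero
    (- 2 / 3) e7))).
  by field; rewrite ?K0.
- apply: (eq_by_zero (add_zero (add_zero (add_zero (scale_zero (- 1) e0)
    (scale_zero (- 4 / 3) e5)) (scale_zero (- 2 / 3) e6)) (scale_zero
    (2 / 3) e7))).
  by field; rewrite ?K0.
- apply: (eq_by_zero (add_zero (add_zero (add_zero (scale_zero (- 3) e0)
    (scale_zero (- 1 / 6) e2)) (scale_zero (2 / 3) e4)) (scale_zero
    (- 4 / 3) e6))).
  by field; rewrite ?K0.
- apply: (eq_by_zero (add_zero (add_zero (add_zero (scale_zero (- 1 / 3) e2)
    (scale_zero (- 2 / 3) e4)) (scale_zero (- 2) e5)) (scale_zero
    (- 2 / 3) e6))).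
  by field; rewrite ?K0.
Qed.

Lemma rigid_second_right : @rigid K 2 2 a_2 b_2 c_0 m_2 A_0 B_0 0%:M 1%:M (- 2)%:M.
Proof.
rigid_entries (mx2 (1 / 2) 0 0 (1 / 2) : 'M[K]_2).
have {}a1E : a1 = mx2 u2 u3 (2 * u2) (2 * u3).
  by rewrite a1E; entries.
have {}m1E : m1 = mx2 (- 1 / 2 * u2) (- 1 / 2 * u3) (- 9 / 4 * u2)
    (- 9 / 4 * u3).
  by rewrite m1E a1E; entries.
have {}G1E : G1 = mx2 (- u0 - 1 / 2 * u2) (- u1 - 1 / 2 * u3)
    (3 / 2 * u0 - 1 / 4 * u2) (3 / 2 * u1 - 1 / 4 * u3).
  by rewrite G1E m1E a1E; entries.
move: e5; rewrite G1E !mx2E =>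
  /mx2_inj[/eq_sub0 e4 /eq_sub0 e5 /eq_sub0 e6 /eq_sub0 e7]; congr mx2.
- apply: (eq_by_zero (add_zero (scale_zero (- 1 / 2) e2) (scale_zero 1 e4))).
  by field; rewrite ?K0.
- apply: (eq_by_zero (add_zero (scale_zero (- 1 / 2) e3) (scale_zero 1 e5))).
  by field; rewrite ?K0.
- by apply: (eq_by_zero (scale_zero 1 e4)); field; rewrite ?K0.
- by apply: (eq_by_zero (scale_zero 1 e5)); field; rewrite ?K0.
Qed.

Lemma rigid_second_left :
  @rigid K 2 2 0%:M 1%:M (- 2)%:M (- 2)%:M 0%:M 1%:M a_2 b_2 c_0.
Proof.
rigid_entries (mx2 (- 1 / 4) 0 (- 1 / 4) (1 / 2) : 'M[K]_2).
have {}a1E : a1 = mx2 (2 * u0 + 4 * u1) (- u0 - 2 * u1) (2 * u2 + 4 * u3)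
    (- u2 - 2 * u3).
  by rewrite a1E; entries.
have {}m1E : m1 = mx2 (- 5 / 2 * u0 - 5 * u1) 0 (- 5 / 2 * u2 - 5 * u3) 0.
  by rewrite m1E a1E; entries.
have {}G1E : G1 = mx2 (1 / 2 * u0 - 3 * u1) (1 / 2 * u0 + 3 * u1)
    (1 / 2 * u2 - 3 * u3) (1 / 2 * u2 + 3 * u3).
  by rewrite G1E m1E a1E; entries.
move: e5; rewrite G1E !mx2E =>
  /mx2_inj[/eq_sub0 e4 /eq_sub0 e5 /eq_sub0 e6 /eq_sub0 e7]; congr mx2.
- by apply: (eq_by_zero (scale_zero (- 1) e4)); field; rewrite ?K0.
- by apply: (eq_by_zero (scale_zero (- 1 / 2) e0)); field; rewrite ?K0.
- by apply: (eq_by_zero (scale_zero (- 1) e6)); field; rewrite ?K0.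
- by apply: (eq_by_zero (scale_zero (- 1 / 2) e2)); field; rewrite ?K0.
Qed.

Lemma rigid_third : @rigid K 2 2 a_3 b_3 c_0 m_3 A_0 B_0 a_3 b_3 c_0.
Proof.
rigid_entries (mx2 (1 / 5) (3 / 10) (- 13 / 10) (- 7 / 10) : 'M[K]_2).
have {}a1E : a1 = mx2 (4 / 5 * u0 - 16 / 5 * u1 + 1 / 5 * u2 + 16 / 5 * u3)
    (1 / 5 * u0 - 4 / 5 * u1 - 1 / 5 * u2 + 9 / 5 * u3)
    (- 16 / 5 * u0 + 64 / 5 * u1 - 24 / 5 * u2 + 16 / 5 * u3)
    (- 4 / 5 * u0 + 16 / 5 * u1 - 1 / 5 * u2 - 16 / 5 * u3).
  by rewrite a1E; entries.
have {}m1E : m1 = mx2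
    (- 9 / 10 * u0 + 18 / 5 * u1 - 3 / 10 * u2 - 33 / 10 * u3)
    (- 1 / 10 * u0 + 2 / 5 * u1 + 4 / 5 * u2 - 37 / 10 * u3)
    (31 / 10 * u0 - 62 / 5 * u1 + 26 / 5 * u2 - 53 / 10 * u3)
    (9 / 10 * u0 - 18 / 5 * u1 + 3 / 10 * u2 + 33 / 10 * u3).
  by rewrite m1E a1E; entries.
have {}G1E : G1 = mx2
    (- 5 / 2 * u0 + 6 / 5 * u1 - 17 / 10 * u2 + 21 / 10 * u3)
    (- 1 / 5 * u0 - 7 / 5 * u1 - 1 / 10 * u2 - 7 / 5 * u3)
    (3 / 2 * u0 + 6 / 5 * u1 + 4 / 5 * u2 - 39 / 10 * u3)
    (- 1 / 5 * u0 + 13 / 5 * u1 + 9 / 10 * u2 - 22 / 5 * u3).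
  by rewrite G1E m1E a1E; entries.
move: e5; rewrite G1E !mx2E =>
  /mx2_inj[/eq_sub0 e4 /eq_sub0 e5 /eq_sub0 e6 /eq_sub0 e7]; congr mx2.
- apply: (eq_by_zero (add_zero (add_zero (add_zero (scale_zero
    (- 53 / 100) e0) (scale_zero (- 11 / 150) e5)) (scale_zero
    (- 68 / 75) e6)) (scale_zero (2 / 3) e7))).
  by field; rewrite ?K0.
- apply: (eq_by_zero (add_zero (add_zero (add_zero (scale_zero
    (- 81 / 50) e0) (scale_zero (28 / 75) e5)) (scale_zero (- 112 / 75) e6))
    (scale_zero (17 / 15) e7))).
  by field; rewrite ?K0.
- apply: (eq_by_zero (add_zero (add_zero (add_zero (scale_zero (7 / 100) e0)
    (scale_zero (- 41 / 150) e5)) (scale_zero (52 / 75) e6)) (scale_zero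
    (- 8 / 15) e7))).
  by field; rewrite ?K0.
- apply: (eq_by_zero (add_zero (add_zero (add_zero (scale_zero (53 / 100) e0)
    (scale_zero (- 5 / 6) e3)) (scale_zero (11 / 150) e5)) (scale_zero
    (- 7 / 75) e6))).
  by field; rewrite ?K0.
Qed.

Lemma rigid_third_right : @rigid K 2 2 a_3 b_3 c_0 m_3 A_0 B_0 0%:M 1%:M (- 2)%:M.
Proof.
rigid_entries (mx2 (1 / 2) 0 0 (1 / 2) : 'M[K]_2).
have {}a1E : a1 = mx2 u2 u3 (- 4 * u2) (- 4 * u3).
  by rewrite a1E; entries.
have {}m1E : m1 = mx2 (- 1 / 2 * u2) (- 1 / 2 * u3) (9 / 2 * u2) (9 / 2 * u3).
  by rewrite m1E a1E; entries.
have {}G1E : G1 = mx2 (- 11 / 5 * u0 - 23 / 10 * u2)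
    (- 11 / 5 * u1 - 23 / 10 * u3) (9 / 5 * u0 - 13 / 10 * u2)
    (9 / 5 * u1 - 13 / 10 * u3).
  by rewrite G1E m1E a1E; entries.
move: e5; rewrite G1E !mx2E =>
  /mx2_inj[/eq_sub0 e4 /eq_sub0 e5 /eq_sub0 e6 /eq_sub0 e7]; congr mx2.
- apply: (eq_by_zero (add_zero (scale_zero (- 1 / 2) e2) (scale_zero
    (1 / 4) e4))).
  by field; rewrite ?K0.
- apply: (eq_by_zero (add_zero (scale_zero (- 1 / 2) e3) (scale_zero
    (1 / 4) e5))).
  by field; rewrite ?K0.
- apply: (eq_by_zero (add_zero (scale_zero (- 1 / 2) e0) (scale_zero
    (1 / 4) e4))).
  by field; rewrite ?K0.
- apply: (eq_by_zero (add_zero (scale_zero (- 1 / 2) e1) (scale_zero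
    (1 / 4) e5))).
  by field; rewrite ?K0.
Qed.

Lemma rigid_third_left :
  @rigid K 2 2 0%:M 1%:M (- 2)%:M (- 2)%:M 0%:M 1%:M a_3 b_3 c_0.
Proof.
rigid_entries (mx2 (1 / 5) (3 / 10) (- 13 / 10) (- 7 / 10) : 'M[K]_2).
have {}a1E : a1 = mx2 (4 / 5 * u0 - 16 / 5 * u1) (1 / 5 * u0 - 4 / 5 * u1)
    (4 / 5 * u2 - 16 / 5 * u3) (1 / 5 * u2 - 4 / 5 * u3).
  by rewrite a1E; entries.
have {}m1E : m1 = mx2 (- u0 + 4 * u1) 0 (- u2 + 4 * u3) 0.
  by rewrite m1E a1E; entries.
have {}G1E : G1 = mx2 (7 / 5 * u0 + 12 / 5 * u1) (- 2 / 5 * u0 + 18 / 5 * u1)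
    (7 / 5 * u2 + 12 / 5 * u3) (- 2 / 5 * u2 + 18 / 5 * u3).
  by rewrite G1E m1E a1E; entries.
move: e5; rewrite G1E !mx2E =>
  /mx2_inj[/eq_sub0 e4 /eq_sub0 e5 /eq_sub0 e6 /eq_sub0 e7]; congr mx2.
- apply: (eq_by_zero (add_zero (scale_zero (6 / 5) e0) (scale_zero
    (1 / 5) e4))).
  by field; rewrite ?K0.
- apply: (eq_by_zero (add_zero (scale_zero (- 1 / 5) e0) (scale_zero
    (1 / 5) e5))).
  by field; rewrite ?K0.
- apply: (eq_by_zero (add_zero (scale_zero (6 / 5) e2) (scale_zero
    (1 / 5) e6))).
  by field; rewrite ?K0.
- apply: (eq_by_zero (add_zero (scale_zero (- 1 / 5) e2) (scale_zero
    (1 / 5) e7))).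
  by field; rewrite ?K0.
Qed.

End Rigidity.

Section ThreePoints.

Variables (K : fieldType) (K_char0 : [pchar K] =i pred0) (k : nat).

Let K0 (n : nat) : (n%:R == 0 :> K) = (n == 0)%N.
Proof. by have /pcharf0P-> := K_char0. Qed.

(** The scalars [0, 1, -2, -1] satisfy [0 ^ 2 = 0] and [1 ^ 2 = (-1) ^ 2 = 1], and
    the differences that [F] inverts are nonzero. *)
Definition block_point (a b : 'M[K]_2) : quad K (2 + k) :=
  (blk k a 0, blk k b 1, blk k c_0 (- 2), blk k d_0 (- 1)).

Definition block_value : quad K (2 + k) :=
  (blk k A_0 0, blk k B_0 1, blk k c_0 (- 2), C (blk k c_0 (- 2)) (blk k d_0 (- 1))).

Lemma block_point_fibre (a b m : 'M[K]_2) :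
  let G := m *m a - m *m b - a *m b + b *m b in
  a *m a = 0 -> b *m b = 1%:M ->
  [/\ b - a \in unitmx, a - c_0 \in unitmx, b - d_0 \in unitmx,
      b - c_0 \in unitmx & G \in unitmx] ->
  A_0 *m (b - a) = (b - a) *m a -> m *m (a - c_0) = (a - c_0) *m c_0 ->
  B_0 *m G = G *m b ->
  rigid a b c_0 m A_0 B_0 a b c_0 ->
  rigid a b c_0 m A_0 B_0 (0%:M : 'M_2) 1%:M (- 2)%:M ->
  rigid (0%:M : 'M_2) 1%:M (- 2)%:M (- 2)%:M 0%:M 1%:M a b c_0 ->
  [/\ F_dom (block_point a b), F (block_point a b) = block_value
    & forall s, dF (block_point a b) s = (0, 0, 0, 0) -> s = (0, 0, 0, 0)].
Proof.
move=> G aa bb [ba ac bd bc Gu] AE mE GE rpp rps rsp.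
have nat0 (n : nat) (z : K) : z = n.+1%:R \/ z = - n.+1%:R -> z != 0.
  by case=> ->; rewrite ?oppr_eq0 K0.
have dd : (d_0 : 'M[K]_2) *m d_0 = 1%:M.
  by rewrite mx2M mx2_scalar; congr mx2; ring.
have GbE : blk k m (- 2) *m blk k a 0 - blk k m (- 2) *m blk k b 1
    - blk k a 0 *m blk k b 1 + blk k b 1 *m blk k b 1 = blk k G 3.
  by rewrite !(blkM, blkB, blkD); congr (blk k _ _); ring.
have dom_ba : C_dom (blk k b 1) (blk k a 0).
  by rewrite /C_dom blkB blk_unitmx //; apply: (nat0 0%N); left; ring.
have dom_ac : C_dom (blk k a 0) (blk k c_0 (- 2)).
  by rewrite /C_dom blkB blk_unitmx //; apply: (nat0 1%N); left; ring.
have dom_ab : C_dom (blk k a 0) (blk k b 1).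
  rewrite /C_dom blkB blk_unitmx //; last by apply: (nat0 0%N); right; ring.
  by rewrite -opprB -scaleN1r unitmxZ ?unitrN1.
have dom_bd : C_dom (blk k b 1) (blk k d_0 (- 1)).
  by rewrite /C_dom blkB blk_unitmx //; apply: (nat0 1%N); left; ring.
have dom_bc : C_dom (blk k b 1) (blk k c_0 (- 2)).
  by rewrite /C_dom blkB blk_unitmx //; apply: (nat0 2%N); left; ring.
have dom_cd : C_dom (blk k (c_0 : 'M[K]_2) (- 2)) (blk k d_0 (- 1)).
  rewrite /C_dom blkB blk_unitmx //; last by apply: (nat0 0%N); right; ring.
  by rewrite !mx2E; apply: (mx2_unitmx (det := 2)); [ring | rewrite K0].
have cu : blk k (c_0 : 'M[K]_2) (- 2) *m blk k c_0 (- 2) - 1%:M \in unitmx.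
  rewrite -blk1 blkM blkB blk_unitmx //; last by apply: (nat0 2%N); left; ring.
  by rewrite mx2_scalar !mx2E; apply: (mx2_unitmx (det := 5)); [ring | rewrite K0].
have aa' : blk k a 0 *m blk k a 0 = 0.
  by rewrite blkM aa mulr0 /blk raddf0 block_mx0.
have bb' : blk k b 1 *m blk k b 1 = 1%:M by rewrite blkM bb mulr1 blk1.
have dd' : blk k (d_0 : 'M[K]_2) (- 1) *m blk k d_0 (- 1) = 1%:M.
  by rewrite blkM dd mulrNN mulr1 blk1.
have AE' : blk k A_0 0 *m (blk k b 1 - blk k a 0) =
    (blk k b 1 - blk k a 0) *m blk k a 0.
  by rewrite blkB !blkM AE mulr0 mul0r.
have mE' : blk k m (- 2) *m (blk k a 0 - blk k c_0 (- 2)) =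
    (blk k a 0 - blk k c_0 (- 2)) *m blk k c_0 (- 2).
  by rewrite blkB !blkM mE mulrC.
have Gu' : blk k m (- 2) *m blk k a 0 - blk k m (- 2) *m blk k b 1
    - blk k a 0 *m blk k b 1 + blk k b 1 *m blk k b 1 \in unitmx.
  by rewrite GbE blk_unitmx // K0.
have GE' : blk k B_0 1 *m (blk k m (- 2) *m blk k a 0 - blk k m (- 2) *m blk k b 1
    - blk k a 0 *m blk k b 1 + blk k b 1 *m blk k b 1) =
    (blk k m (- 2) *m blk k a 0 - blk k m (- 2) *m blk k b 1
    - blk k a 0 *m blk k b 1 + blk k b 1 *m blk k b 1) *m blk k b 1.
  by rewrite GbE !blkM GE mulrC.
split.
- exact: (involutive_F_dom bb' dd' dom_ba dom_ac dom_ab dom_bd dom_bc dom_cd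
    mE' Gu' cu).
- exact: (involutive_F_value bb' dd' dom_ba dom_ac dom_ab dom_bd dom_bc
    AE' mE' Gu' GE' cu).
apply: (involutive_dF_injective aa' bb' dd' dom_ba dom_ac dom_ab dom_bd
  dom_bc dom_cd AE' mE' Gu' GE' cu).
apply: rigid_blk; [| | exact: rpp | |].
- by rewrite oppr_eq0 K0.
- by rewrite -subr_eq0; apply: (nat0 2%N); right; ring.
- exact: rigid_scalar_right rps.
- exact: rigid_scalar_left rsp.
Qed.

End ThreePoints.

(** The three points are told apart by an entry of [b]. *)
Lemma qcoord_b (R : Type) n (i j : 'I_n) :
  exists l, forall a b c d : 'M[R]_n, qcoord (a, b, c, d) l = b i j.
Proof.
exists (lshift _ (lshift _ (rshift _ (mxvec_index i j)))) => a b c d.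
by rewrite /= row_mxEl row_mxEl row_mxEr mxvecE.
Qed.

Section ThreePointFibre.

Variables (K : fieldType) (K_char0 : [pchar K] =i pred0) (k : nat).

Let K0 (n : nat) : (n%:R == 0 :> K) = (n == 0)%N.
Proof. by have /pcharf0P-> := K_char0. Qed.

Let in_fibre (x : quad K (2 + k)) : Prop :=
  [/\ F_dom x, F x = block_value K k
    & forall s, dF x s = (0, 0, 0, 0) -> s = (0, 0, 0, 0)].

Ltac unit_by delta := apply: (@mx2_unitmx _ _ _ _ _ delta);
  [field; rewrite ?K0 | rewrite ?mulf_eq0 ?invr_eq0 ?oppr_eq0 ?oner_eq0 ?K0].

Lemma first_point : in_fibre (block_point k a_1 b_1).
Proof.
apply: (@block_point_fibre K K_char0 k _ _ m_1); last 3 first.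
- exact: rigid_first.
- exact: rigid_first_right.
- exact: rigid_first_left.
all: rewrite ?mx2_scalar !mx2E -?mx2_zero.
1,2,4-6: by congr mx2; field; rewrite ?K0.
split.
- by unit_by (- 1 : K).
- by unit_by (4 : K).
- by unit_by (6 : K).
- by unit_by (15 : K).
- by unit_by (- 5 : K).
Qed.

Lemma second_point : in_fibre (block_point k a_2 b_2).
Proof.
apply: (@block_point_fibre K K_char0 k _ _ m_2); last 3 first.
- exact: rigid_second.
- exact: rigid_second_right.
- exact: rigid_second_left.
all: rewrite ?mx2_scalar !mx2E -?mx2_zero.
1,2,4-6: by congr mx2; field; rewrite ?K0.
split.
- by unit_by (1 : K).
- by unit_by (- 8 : K).
- by unit_by (- 4 : K).
- by unit_by (- 3 : K).
- by unit_by (1 : K).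
Qed.

Lemma third_point : in_fibre (block_point k a_3 b_3).
Proof.
apply: (@block_point_fibre K K_char0 k _ _ m_3); last 3 first.
- exact: rigid_third.
- exact: rigid_third_right.
- exact: rigid_third_left.
all: rewrite ?mx2_scalar !mx2E -?mx2_zero.
1,2,4-6: by congr mx2; field; rewrite ?K0.
split.
- by unit_by (- 5 : K).
- by unit_by (4 : K).
- by unit_by (- 2 / 5 : K).
- by unit_by (3 : K).
- by unit_by (- 5 : K).
Qed.

End ThreePointFibre.

Theorem proposition6p1 (K : fieldType) (charK0 : [pchar K] =i pred0)
    (Kbar : closedFieldType) (iota : {rmorphism K -> Kbar})
    (Kbar_alg : forall z : Kbar, algebraicOver iota z)
    (n : nat) (n_ge2 : (2 <= n)%N) :
  exists2 d : nat,
    has_geometric_degree (@F_dom Kbar n) (@F Kbar n) d & (3 <= d)%N.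
Proof.
have L0 : [pchar Kbar] =i pred0.
  by move=> p; rewrite -(charK0 p) (fmorph_pchar iota).
have K0 (r : nat) : (r%:R == 0 :> Kbar) = (r == 0)%N.
  by have /pcharf0P-> := L0.
move: (n - 2)%N (subnKC n_ge2) => k <- {n n_ge2}.
pose a (j : 'I_3) := nth 0 [:: a_1 : 'M[Kbar]_2; a_2; a_3] j.
pose b (j : 'I_3) := nth 0 [:: b_1 : 'M[Kbar]_2; b_2; b_3] j.
pose x j := block_point k (a j) (b j).
have xP j : [/\ F_dom (x j), F (x j) = block_value Kbar k
    & forall s, dF (x j) s = (0, 0, 0, 0) -> s = (0, 0, 0, 0)].
  case: j => [[|[|[|j]]] ltj] //.
  - exact: first_point.
  - exact: second_point.
  - exact: third_point.
have [l lE] := @qcoord_b Kbar (2 + k) 0 0.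
have [] // := @F_degree_lower_bound Kbar L0 (2 + k) 2 x (block_value Kbar k) l.
- by move=> j; have [] := xP j.
- by move=> j; have [] := xP j.
- have x0 j : qcoord (x j) l = nth 0 [:: 1; - 1; 1 / 5] j.
    rewrite lE /blk (_ : 0 = lshift k (0 : 'I_2)) ?block_mxEul; last exact: val_inj.
    by case: j => [[|[|[|j]]] ltj] //; rewrite mxE.
  have neq (r : nat) (y z s : Kbar) : (y - z) * s = r.+1%:R -> (y == z) = false.
    by move=> e; apply/negP => /eqP yz; move/eqP: e; rewrite yz subrr mul0r eq_sym K0.
  move=> i j; rewrite !x0 => /eqP; rewrite nth_uniq //.
    by move/eqP/val_inj.
  rewrite /= !inE negb_or (neq 1%N _ _ 1) 1?(neq 3%N _ _ 5) 1?(neq 5%N _ _ (- 5)) //.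
  - by field; rewrite K0.
  - by field; rewrite K0.
  - by ring.
- by move=> j; have [] := xP j.
by move=> d deg lt2d; exists d.
Qed.
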